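(* Let $\rho:\pi_1^{\mathrm{orb}}(T^8/\Gamma)\to SO(7)$ be a representation with $\rho(\alpha)=\rho(\beta)=1$ and such that $\rho(\gamma)$ and $\rho(\delta)$ commute, with at least one of them non-trivial. If $\rho(\tau_4),\rho(\tau_5),\rho(\tau_8)$ are gauge equivalent (i.e. simultaneously conjugate by a change of basis) to the diagonal matrices with entries $$(-1,-1,-1,-1,1,1,1),\quad(-1,-1,1,1,-1,-1,1),\quad(1,-1,-1,1,1,-1,-1),$$ then $\rho$ is valid for the construction, i.e. the associated flat connection is irreducible, infinitesimally rigid and unobstructed.
   Context: $\pi_1^{\mathrm{orb}}(T^8/\Gamma)$ is the group of affine isometries of $\mathbb R^8$ generated by $\alpha:(x_1,\dots,x_8)\mapsto(-x_1,-x_2,-x_3,-x_4,x_5,x_6,x_7,x_8)$, $\beta:\ \mapsto(x_1,x_2,x_3,x_4,-x_5,-x_6,-x_7,-x_8)$, $\gamma:\ \mapsto(\frac12-x_1,\frac12-x_2,x_3,x_4,\frac12-x_5,\frac12-x_6,x_7,x_8)$, $\delta:\ \mapsto(-x_1,x_2,\frac12-x_3,x_4,\frac12-x_5,x_6,\frac12-x_7,x_8)$, and the unit translations $\tau_i:x_i\mapsto x_i+1$ ($i=1,\dots,8$). $\Gamma$ is the group generated by $\alpha,\beta,\gamma,\delta$ acting on $T^8=\mathbb R^8/\mathbb Z^8$. The flat $Spin(7)$-structure on $T^8/\Gamma$ is (with $dx_{ijkl}=dx_i\wedge dx_j\wedge dx_k\wedge dx_l$) $\Omega_0=dx_{1234}+dx_{1256}+dx_{1278}+dx_{1357}-dx_{1368}-dx_{1458}-dx_{1467}-dx_{2358}-dx_{2367}-dx_{2457}+dx_{2468}+dx_{3456}+dx_{3478}+dx_{5678}$;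 $\Lambda^2_7$ is the rank 7 eigenspace of $\omega\mapsto*(\Omega_0\wedge\omega)$ on 2-forms with eigenvalue $3$, and $\pi^2_7$ the orthogonal projection onto it. A homomorphism $\rho$ to $G$ determines an orbifold $G$-bundle $E_0=(\mathbb R^8\times G)/\pi_1^{\mathrm{orb}}(T^8/\Gamma)$ over $T^8/\Gamma$ with flat connection $\theta$, the flat connection associated with $\rho$. Let $\mathcal H^i_\theta$ be the cohomology of $0\to\Gamma(\mathrm{Ad}E_0)\xrightarrow{d_\theta}\Gamma(\Lambda^1\otimes\mathrm{Ad}E_0)\xrightarrow{\pi^2_7d_\theta}\Gamma(\Lambda^2_7\otimes\mathrm{Ad}E_0)\to0$ (sections on the orbifold are the equivariant ones upstairs). $\theta$ is irreducible if $\mathcal H^0_\theta=0$, infinitesimally rigid if $\mathcal H^1_\theta=0$, unobstructed if $\mathcal H^2_\theta=0$. *)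

(* Defs.v *)
From mathcomp Require Import all_boot all_order all_algebra.
From mathcomp Require Import all_classical all_reals all_analysis.
Set Implicit Arguments.
Unset Strict Implicit.
Unset Printing Implicit Defensive.
Import Order.TTheory GRing.Theory Num.Theory.
Import numFieldNormedType.Exports.
Local Open Scope ring_scope.

(* 1-based coordinate indices: [idx 1], ..., [idx 8]. *)
Definition idx (k : nat) : 'I_8 := inord k.-1.

Section ExteriorAlgebra.
Context {R : realType}.

(* An element of Lambda^* (R^8)^* (x) V is given by its coefficients on the
   basis dx_I = dx_i1 /\ ... /\ dx_ik, I = {i1 < ... < ik}. *)
Definition form (V : lmodType R) := {ffun {set 'I_8} -> V}.

(* The s with dx_I /\ dx_J = s dx_(I u J). *)
Definition wedge_sign (I J : {set 'I_8}) : R :=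
  if [disjoint I & J] then
    (-1) ^+ #|[set p : 'I_8 * 'I_8 |
                [&& p.1 \in I, p.2 \in J & (p.2 < p.1)%N]]|
  else 0.

Definition wedge {V : lmodType R} (a : form R^o) (b : form V) : form V :=
  [ffun K : {set 'I_8} => \sum_(I : {set 'I_8} | I \subset K)
     (wedge_sign I (K :\: I) * a I) *: b (K :\: I)].

Definition form_one : form R^o :=
  [ffun I : {set 'I_8} => (I == finset.set0)%:R].

Definition dx1 (i : 'I_8) : form R^o :=
  [ffun I : {set 'I_8} => (I == [set i])%:R].

(* [dx [:: i1; ...; ik]] is dx_i1 /\ ... /\ dx_ik, with 1-based indices. *)
Definition dx (s : seq nat) : form R^o :=
  \big[@wedge R^o/form_one]_(i <- s) dx1 (idx i).

(* Hodge star of the Euclidean metric and the orientation dx_12345678: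
   it sends dx_I to the sign of (I, I^c) times dx_(I^c). *)
Definition star {V : lmodType R} (a : form V) : form V :=
  [ffun K : {set 'I_8} => wedge_sign (~: K) K *: a (~: K)].

Definition of_degree {V : lmodType R} (k : nat) : set (form V) :=
  [set a | forall I : {set 'I_8}, #|I| != k -> a I = 0]%classic.

Definition Omega0 : form R^o :=
    dx [:: 1; 2; 3; 4]%N + dx [:: 1; 2; 5; 6]%N + dx [:: 1; 2; 7; 8]%N
  + dx [:: 1; 3; 5; 7]%N - dx [:: 1; 3; 6; 8]%N - dx [:: 1; 4; 5; 8]%N
  - dx [:: 1; 4; 6; 7]%N - dx [:: 2; 3; 5; 8]%N - dx [:: 2; 3; 6; 7]%N
  - dx [:: 2; 4; 5; 7]%N + dx [:: 2; 4; 6; 8]%N + dx [:: 3; 4; 5; 6]%N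
  + dx [:: 3; 4; 7; 8]%N + dx [:: 5; 6; 7; 8]%N.

(* Lambda^2_7 (x) V: the eigenvalue 3 eigenspace of *(Omega0 /\ _). *)
Definition Lambda27 {V : lmodType R} : set (form V) :=
  (of_degree 2 `&` [set w | star (wedge Omega0 w) = 3%:R *: w])%classic.

(* Contraction by the inner product for which the dx_I are orthonormal. *)
Definition form_dot {V : lmodType R} (l : form R^o) (w : form V) : V :=
  \sum_(I : {set 'I_8}) l I *: w I.

(* Orthogonal projection of Lambda^2 (x) V onto Lambda^2_7 (x) V: the unique
   element of Lambda^2_7 (x) V whose difference with w is orthogonal to
   Lambda^2_7. *)
Definition pi27 {V : lmodType R} (w : form V) : form V :=
  xget 0 [set e | Lambda27 e /\
                  forall l : form R^o, Lambda27 l -> form_dot l (w - e) = 0]%classic.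

End ExteriorAlgebra.

Section DifferentialForms.
Context {R : realType} {V : normedModType R}.
Notation E := 'rV[R]_8.

Definition partial (i : 'I_8) (f : E -> V) : E -> V :=
  fun x => 'D_(delta_mx 0 i) f x.

(* C^infinity: every iterated partial derivative exists and is Frechet
   differentiable everywhere. *)
Definition smooth (f : E -> V) : Prop :=
  forall (s : seq 'I_8) (x : E), differentiable (foldr partial f s) x.

Definition smooth_form (a : E -> form V) : Prop :=
  forall I : {set 'I_8}, smooth (fun x => a x I).

(* d a = sum_i dx_i /\ (partial_i a) *)
Definition extd (a : E -> form V) : E -> form V := fun x =>
  \sum_(i < 8) wedge (dx1 i) [ffun I => partial i (fun y => a y I) x].

(* g^* (sum_I a_I dx_I) = sum_I (a_I o g) dg_i1 /\ ... /\ dg_ik, where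
   dg_i = sum_j (partial_j g_i) dx_j; ['J g x] acts on row vectors, so its
   (j, i) entry is partial_j g_i. *)
Definition pullback (g : E -> E) (a : E -> form V) : E -> form V := fun x =>
  \sum_(I : {set 'I_8})
    [ffun K => (\big[@wedge R R^o/form_one]_(i <- enum I)
                  \sum_(j < 8) ('J g x) j i *: dx1 j) K *: a (g x) I].

End DifferentialForms.

Section OrbifoldGroup.
Variable R : realType.
Notation E := 'rV[R]_8.

Definition diag_affine (s t : seq R) : E -> E :=
  fun x => \row_(i < 8) (s`_i * x 0 i + t`_i).

Definition orb_alpha : E -> E :=
  diag_affine [:: -1; -1; -1; -1; 1; 1; 1; 1] [:: 0; 0; 0; 0; 0; 0; 0; 0].
Definition orb_beta : E -> E :=
  diag_affine [:: 1; 1; 1; 1; -1; -1; -1; -1] [:: 0; 0; 0; 0; 0; 0; 0; 0].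
Definition orb_gamma : E -> E :=
  diag_affine [:: -1; -1; 1; 1; -1; -1; 1; 1]
              [:: 2^-1; 2^-1; 0; 0; 2^-1; 2^-1; 0; 0].
Definition orb_delta : E -> E :=
  diag_affine [:: -1; 1; -1; 1; -1; 1; -1; 1]
              [:: 0; 0; 2^-1; 0; 2^-1; 0; 2^-1; 0].
Definition orb_tau (i : 'I_8) : E -> E := fun x => x + delta_mx 0 i.

Inductive pi1orb : set (E -> E) :=
  | pi1orb_alpha : pi1orb orb_alpha
  | pi1orb_beta : pi1orb orb_beta
  | pi1orb_gamma : pi1orb orb_gamma
  | pi1orb_delta : pi1orb orb_delta
  | pi1orb_tau i : pi1orb (orb_tau i)
  | pi1orb_id : pi1orb id
  | pi1orb_comp g h : pi1orb g -> pi1orb h -> pi1orb (g \o h)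
  | pi1orb_inv g h : pi1orb g -> cancel g h -> cancel h g -> pi1orb h.

End OrbifoldGroup.

Local Open Scope classical_set_scope.
Local Open Scope ring_scope.

Section FlatConnection.
Context {R : realType}.
Notation E := 'rV[R]_8.

Definition SO {n : nat} : set 'M[R]_n :=
  [set A | A *m A^T = 1%:M /\ \det A = 1].

Definition so {n : nat} : set 'M[R]_n := [set X | X^T = - X].

(* Homomorphisms pi_1^orb(T^8/Gamma) -> SO(7); values outside of the group
   are irrelevant. *)
Definition representation (rho : (E -> E) -> 'M[R]_7) : Prop :=
  (forall g, pi1orb g -> SO (rho g)) /\
  (forall g h, pi1orb g -> pi1orb h -> rho (g \o h) = rho g *m rho h).

Variable rho : (E -> E) -> 'M[R]_7.

(* Smooth sections of Lambda^k (x) Ad E_0 over the orbifold, as smooth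
   so(7)-valued k-forms on R^8 equivariant for the action
   g (x, h) = (g x, rho(g) h) of the orbifold group on R^8 x SO(7).  On these,
   d_theta is the exterior derivative [extd]. *)
Definition Ad_forms (k : nat) : set (E -> form 'M[R]_7) :=
  [set a | [/\ smooth_form a,
      forall x, of_degree k (a x),
      forall x I, so (a x I) &
      forall g, pi1orb g -> forall x I,
        pullback g a x I = rho g *m a x I *m invmx (rho g)]].

Definition Ad_forms27 : set (E -> form 'M[R]_7) :=
  Ad_forms 2 `&` [set w | forall x, Lambda27 (w x)].

Definition pi27_extd (a : E -> form 'M[R]_7) : E -> form 'M[R]_7 :=
  fun x => pi27 (extd a x).

(* H^0 = 0, H^1 = 0 and H^2 = 0 for the complex
   Ad_forms 0 --extd--> Ad_forms 1 --pi27_extd--> Ad_forms27 --> 0. *)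
Definition irreducible : Prop :=
  Ad_forms 0 `&` [set a | extd a = 0] `<=` [set 0].

Definition infinitesimally_rigid : Prop :=
  Ad_forms 1 `&` [set a | pi27_extd a = 0] `<=` extd @` Ad_forms 0.

Definition unobstructed : Prop :=
  Ad_forms27 `<=` pi27_extd @` Ad_forms 1.

End FlatConnection.

Definition diag7 {R : realType} (s : seq R) : 'M[R]_7 :=
  diag_mx (\row_(i < 7) s`_i).

(* Main.v *)
(* The translations act on so(7) without nonzero fixed vectors: rho (tau_4),
   rho (tau_5), rho (tau_8) are simultaneously diagonal with seven different
   joint signs, so a skew matrix commuting with all of them vanishes.  As alpha
   and beta act trivially, every rho (tau_i) is an involution, so equivariant
   so(7)-valued forms have 2-periodic coefficients, of mean value 0.

   On smooth 2-periodic functions of mean 0 the Laplacian has an inverse G,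
   obtained by expanding in cosine modes one coordinate after the other; it
   commutes with derivatives and with the maps x_i |-> +-x_i + t_i.  Let
   D = (1 + *(Omega0 /\ .)) d = 4 pi27 d, and (delta w)_j = sum_i d_i w_ij.
   Then delta (D a) = Lap a - d (sum_j d_j a_j) for 1-forms a, because Omega0
   is parallel, and D (delta w) = Lap w for sections w of Lambda^2_7.  Hence
   - H^0: d f = 0 implies f = G (Lap f) = 0;
   - H^1: D a = 0 implies a = G (Lap a) = d (G (sum_j d_j a_j));
   - H^2: w = pi27 (d (4 delta (G w))). *)
Require Import Defs.
From HB Require Import structures.
From mathcomp Require Import all_boot all_order all_algebra.
From mathcomp Require Import all_classical all_reals all_analysis.
From mathcomp Require Import ring lra.
Set Implicit Arguments.
Unset Strict Implicit.
Unset Printing Implicit Defensive.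
Import Order.TTheory GRing.Theory Num.Theory.
Import numFieldNormedType.Exports.
Local Open Scope ring_scope.

(** * Subsets of {0..7} given by lists, and the 4-form Omega0 *)

Section Combinatorics.

(** The obstacle is analytic: without elliptic regularity or Hodge theory, every preimage has to be
    written down and shown smooth and equivariant. Both properties follow from three features of an
    operator T on smooth 2-periodic functions, collected in [goodop]: linearity, commutation with
    the maps x_i |-> +-x_i + t_i, and a sup bound by finitely many derivatives. Translation
    invariance and the bound force T u to be smooth with derivatives T (d_i u); commutation with the
    maps carries over equivariance, since all elements of the orbifold group are of this kind. Hence
    the kernels are even, which leads to cosine modes, and a series of operators only needs
    pointwise convergence with summable bounds. The algebra of Omega0 becomes a list of identities
    with integer coefficients between components or second derivatives, decided by [vm_compute]. The
    factor 4 reflects the eigenvalues 3 and -1 of *(Omega0 /\ .) on 2-forms, which make (1 +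
    *(Omega0 /\ .)) / 4 the projection. *)

Definition set_of_seq (l : seq nat) : {set 'I_8} := [set i | val i \in l].
Definition below8 := all (fun i => i < 8)%N.
Definition inversions (a b : seq nat) : nat :=
  sumn [seq sumn [seq nat_of_bool (j < i)%N | j <- b] | i <- a].

Lemma big_set_of_seq (F : nat -> nat) (a : seq nat) : uniq a -> below8 a ->
  (\sum_(i < 8 | val i \in a) F i = \sum_(i <- a) F i)%N.
Proof.
move=> ua /allP a8; rewrite -(big_mkord (fun i => i \in a)) -big_filter.
apply: perm_big; apply: uniq_perm => //; first by rewrite filter_uniq ?iota_uniq.
move=> i; rewrite mem_filter mem_iota /= add0n subn0.
by case: (boolP (i \in a)) => //= /a8.
Qed.

Lemma card_inversions (a b : seq nat) : uniq a -> uniq b -> below8 a -> below8 b ->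
  #|[set p : 'I_8 * 'I_8 | [&& p.1 \in set_of_seq a, p.2 \in set_of_seq b & (p.2 < p.1)%N]]|
  = inversions a b.
Proof.
move=> ua ub a8 b8; rewrite -sum1_card.
transitivity (\sum_(p : 'I_8 * 'I_8 | (val p.1 \in a) && (val p.2 \in b)) (p.2 < p.1))%N.
  rewrite big_mkcond [RHS]big_mkcond; apply: eq_bigr => p _. 
  by rewrite !inE; case: (_ \in a) => //=; case: (_ \in b) => //=; case: (_ < _)%N.
rewrite -(pair_big (fun i : 'I_8 => val i \in a) (fun j : 'I_8 => val j \in b)
   (fun i j => (val j < val i)%N : nat)) /=.
rewrite /inversions sumnE big_map; under [RHS]eq_bigr do rewrite sumnE big_map.
rewrite -(big_set_of_seq (fun i => \sum_(j <- b) (j < i)%N)%N)//.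
by apply: eq_bigr => i _; rewrite (big_set_of_seq (fun j => (j < i)%N : nat)).
Qed.

Lemma card_set_of_seq (l : seq nat) : uniq l -> below8 l -> #|set_of_seq l| = size l.
Proof.
move=> ul l8; rewrite -sum1_card -sum1_size -(big_set_of_seq (fun=> 1%N))//.
by apply: eq_bigl => i; rewrite inE.
Qed.

Lemma set_of_seqC (l : seq nat) : ~: set_of_seq l = set_of_seq [seq i <- iota 0 8 | i \notin l].
Proof.
by apply/setP => i; rewrite !inE mem_filter mem_iota /= add0n ltn_ord andbT.
Qed.

Lemma set_of_seqD (a b : seq nat) : set_of_seq a :\: set_of_seq b = set_of_seq [seq i <- a | i \notin b].
Proof. by apply/setP => i; rewrite !inE mem_filter. Qed.

Lemma set_of_seqS (a b : seq nat) : below8 a ->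
  (set_of_seq a \subset set_of_seq b) = all (fun i => i \in b) a.
Proof.
move=> /allP a8; apply/fintype.subsetP/allP => [H i ia|H i].
  by have := H (Ordinal (a8 _ ia)); rewrite !inE; apply.
by rewrite !inE => /H.
Qed.

Lemma set_of_seq_disjoint (a b : seq nat) : below8 a ->
  [disjoint set_of_seq a & set_of_seq b] = ~~ has (fun i => i \in b) a.
Proof.
move=> /allP a8; rewrite -setI_eq0; apply/eqP/hasPn => [H i ia|H].
  have /setP/(_ (Ordinal (a8 _ ia))) := H; rewrite !inE /= ia /=.
  by move=> ->.
by apply/setP => i; rewrite !inE; apply/negP => /andP[/H/negP].
Qed.

Definition pairs : seq (seq nat) :=
  [seq l <- [seq [:: i; j] | i <- iota 0 8, j <- iota 0 8] | sorted ltn l].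

Lemma card2_pairs (K : {set 'I_8}) : #|K| = 2%N -> exists2 k, k \in pairs & K = set_of_seq k.
Proof.
move=> /eqP/cards2P[a [b [ab ->]]].
wlog lt_ab : a b ab / (a < b)%N.
  move=> H; have [/(H a b ab)//|ba|/val_inj eab] := ltngtP a b.
    by rewrite finset.setUC; apply: H; rewrite // eq_sym.
  by rewrite eab eqxx in ab.
exists [:: val a; val b]; last by apply/setP => i; rewrite !inE.
rewrite mem_filter; apply/andP; split; first by rewrite /= lt_ab.
by apply: (allpairs_f (fun i j => [:: i; j])); rewrite mem_iota /= add0n ltn_ord.
Qed.

Lemma pairsP k : k \in pairs -> [/\ uniq k, below8 k & size k = 2%N].
Proof.
have : all (fun k => [&& uniq k, below8 k & size k == 2%N]) pairs by vm_compute.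
by move=> /allP H /H /and3P[? ? /eqP].
Qed.

End Combinatorics.

(** * The operator w |-> *(Omega0 /\ w) in coordinates *)

Section Omega.
Context {R : realType}.
Implicit Type (V : lmodType R).

Lemma wedge_signE (a b : seq nat) : uniq a -> uniq b -> below8 a -> below8 b ->
  wedge_sign (R := R) (set_of_seq a) (set_of_seq b) =
  if has (fun i => i \in b) a then 0 else (-1) ^+ inversions a b.
Proof.
by move=> ua ub a8 b8; rewrite /wedge_sign set_of_seq_disjoint// card_inversions//; case: has.
Qed.

Lemma wedge_dx1 V (c : R) (i : 'I_8) (b : Defs.form V) (K : {set 'I_8}) :
  wedge (c *: dx1 i) b K = if i \in K then (c * wedge_sign [set i] (K :\ i)) *: b (K :\ i) else 0.
Proof.
rewrite ffunE; case: ifP => iK.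
  rewrite (bigD1 [set i])/= ?finset.sub1set// big1 ?addr0 => [|I /andP[_ Ii]].
    by rewrite !ffunE eqxx [_ *: 1]mulr1 mulrC.
  by rewrite !ffunE (negbTE Ii) [_ *: 0]mulr0 mulr0 scale0r.
apply: big1 => I IK; rewrite !ffunE.
case: eqP => [II|_]; last by rewrite [_ *: 0]mulr0 mulr0 scale0r.
by move: IK; rewrite II finset.sub1set iK.
Qed.

Lemma wedge_sign_lt (i : 'I_8) (J : {set 'I_8}) : (forall j, j \in J -> (i < j)%N) ->
  wedge_sign (R := R) [set i] J = 1.
Proof.
move=> iJ; rewrite /wedge_sign disjoints1.
have -> : i \notin J by apply/negP => /iJ; rewrite ltnn.
rewrite (_ : [set p | _] = finset.set0) ?cards0//.
apply/finset.setP => -[a b]; rewrite !inE /=; apply/negbTE/negP => /and3P[/eqP-> /iJ].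
by rewrite ltnNge => /negP H /ltnW.
Qed.

Lemma wedge_sign_gt (i j : 'I_8) : (j < i)%N ->
  wedge_sign (R := R) [set i] [set j] = -1.
Proof.
move=> ji; rewrite /wedge_sign disjoints1 inE gt_eqF//.
rewrite (_ : [set p | _] = [set (i, j)]) ?cards1//.
apply/finset.setP => -[a b]; rewrite !inE /= xpair_eqE.
by case: eqP => [->|//]; case: eqP => [->|//]; rewrite ji.
Qed.

(** Each new index is smaller than all those in the tail, so no sign appears. The scalars [c] let
    one computation serve both the monomials of [Omega0] and the pullback by a map with diagonal
    linear part. *)
Lemma wedge_sorted (c : 'I_8 -> R) (s : seq 'I_8) : sorted (fun i j : 'I_8 => i < j)%N s ->
  \big[@wedge R R^o/form_one]_(i <- s) (c i *: dx1 i) =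
  [ffun I : {set 'I_8} => (\prod_(i <- s) c i) * (I == [set j in s])%:R].
Proof.
elim: s => [_|i s IH] /=.
  have E0 : [set j : 'I_8 in [::]] = finset.set0 by apply/finset.setP => j; rewrite !inE.
  apply/ffunP => K; rewrite !big_nil [LHS]ffunE [RHS]ffunE mul1r E0; reflexivity.
rewrite path_sortedE; last by move=> x y z; apply: ltn_trans.
move=> /andP[/allP si /IH sE]; apply/ffunP => K.
rewrite [in LHS]big_cons sE wedge_dx1 !ffunE big_cons.
have -> : [set j in i :: s] = i |: [set j in s] by apply/finset.setP => j; rewrite !inE.
have iS : i \notin [set j in s] by rewrite inE; apply/negP => /si; rewrite ltnn.
case: ifP => iK; last first.
  rewrite (_ : (K == _) = false) ?mulr0//; apply/negbTE/eqP => KE.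
  by rewrite KE !inE eqxx in iK.
have -> : (K == i |: [set j in s]) = (K :\ i == [set j in s]).
  apply/eqP/eqP => [->|<-]; last by rewrite finset.setD1K.
  by rewrite finset.setU1K.
case: eqP => [E|_]; last by rewrite !mulr0 [_ *: 0]mulr0.
rewrite E wedge_sign_lt ?mulr1//; last by move=> j; rewrite inE => /si.
Qed.

Lemma sorted_enum_set (I : {set 'I_8}) : sorted (fun i j : 'I_8 => i < j)%N (enum I).
Proof.
rewrite /enum_mem sorted_filter//; first by move=> x y z; apply: ltn_trans.
have := sorted_map (f := val) (e' := ltn) (enum 'I_8); rewrite val_enum_ord iota_ltn_sorted.
by rewrite /enum_mem filter_predT => /esym.
Qed.

Lemma dx_sorted (s : seq nat) : sorted ltn s -> all (fun i => 0 < i <= 8)%N s ->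
  dx (R := R) s = [ffun I => (I == set_of_seq (map predn s))%:R].
Proof.
move=> ss /allP s8.
have valx i : i \in s -> val (idx i) = i.-1.
  by move=> /s8/andP[i0 i8]; rewrite [LHS]inordK// prednK.
have -> : dx (R := R) s = \big[@wedge R R^o/form_one]_(i <- map idx s) (1 *: dx1 i).
  by rewrite /dx big_map; apply: eq_bigr => i _; rewrite scale1r.
rewrite (wedge_sorted (fun=> 1)).
  apply/ffunP => I; rewrite !ffunE big1_eq mul1r (_ : [set j in map idx s] = set_of_seq (map predn s))//.
  apply/finset.setP => j; rewrite !inE.
  apply/mapP/mapP => -[i iS ji]; exists i => //; first by rewrite ji; exact: valx.
  by apply: val_inj; rewrite ji valx.
rewrite sorted_map; apply: (sub_in_sorted (P := [in s])) ss; last exact/allP.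
move=> i j iS jS; rewrite /= -[nat_of_ord _]/(val _) valx// -[nat_of_ord _]/(val _) valx//.
by move: (s8 _ iS) (s8 _ jS); case: i j {iS jS} => [|i] [|j].
Qed.

(* The monomials of Omega0 with 0-based indices; true stands for a minus sign. *)
Definition Omega_terms : seq (bool * seq nat) :=
  [:: (false, [:: 0; 1; 2; 3]); (false, [:: 0; 1; 4; 5]); (false, [:: 0; 1; 6; 7]);
      (false, [:: 0; 2; 4; 6]); (true, [:: 0; 2; 5; 7]); (true, [:: 0; 3; 4; 7]);
      (true, [:: 0; 3; 5; 6]); (true, [:: 1; 2; 4; 7]); (true, [:: 1; 2; 5; 6]);
      (true, [:: 1; 3; 4; 6]); (false, [:: 1; 3; 5; 7]); (false, [:: 2; 3; 4; 5]);
      (false, [:: 2; 3; 6; 7]); (false, [:: 4; 5; 6; 7])]%N.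

Lemma Omega0E (I : {set 'I_8}) : Omega0 (R := R) I =
  \sum_(q <- Omega_terms) (-1) ^+ q.1 * (I == set_of_seq q.2)%:R.
Proof.
rewrite /Omega0 !dx_sorted//= !ffunE /Omega_terms !big_cons big_nil /=.
by rewrite !expr1 !expr0 !mul1r !mulN1r addr0 -!addrA.
Qed.

Lemma Omega_termsP q : q \in Omega_terms -> [/\ uniq q.2, below8 q.2 & size q.2 = 4%N].
Proof.
have : all (fun q => [&& uniq q.2, below8 q.2 & size q.2 == 4%N]) Omega_terms by vm_compute.
by move=> /allP H /H /and3P[? ? /eqP].
Qed.

Definition compl (k : seq nat) := [seq i <- iota 0 8 | i \notin k].
(** The pair left for w once the monomial s of [Omega0] has been placed inside the complement of
    k. *)
Definition residual (k s : seq nat) := [seq i <- compl k | i \notin s].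
(* ( *(Omega0 /\ w))_k as a list of signed components of w *)
Definition starOmega_terms (k : seq nat) : seq (bool * seq nat) :=
  [seq (q.1 (+) odd (inversions (compl k) k) (+) odd (inversions q.2 (residual k q.2)),
    residual k q.2)
  | q <- Omega_terms & all (fun i => i \in compl k) q.2].

Definition starOmega V (w : Defs.form V) : Defs.form V := star (wedge Omega0 w).

Lemma starOmega_set_of_seq V (w : Defs.form V) k : uniq k -> below8 k ->
  starOmega w (set_of_seq k) = \sum_(q <- starOmega_terms k) (-1) ^+ q.1 *: w (set_of_seq q.2).
Proof.
move=> uk k8; rewrite ffunE ffunE set_of_seqC -/(compl k).
have uc : uniq (compl k) by rewrite filter_uniq ?iota_uniq.
have c8 : below8 (compl k).
  by apply/allP => i; rewrite mem_filter mem_iota => /andP[_ /andP[]].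
rewrite wedge_signE// (_ : has _ _ = false); last first.
  by apply/hasPn => i; rewrite mem_filter => /andP[].
transitivity (\sum_(q <- Omega_terms) (if all (fun i => i \in compl k) q.2 then
   (-1) ^+ (q.1 (+) odd (inversions (compl k) k) (+) odd (inversions q.2 (residual k q.2)))
     *: w (set_of_seq (residual k q.2))
   else 0)); last by rewrite [RHS]big_map [RHS]big_filter [RHS]big_mkcond.
rewrite scaler_sumr.
under eq_bigr => I _ do rewrite Omega0E mulr_sumr scaler_suml scaler_sumr.
rewrite exchange_big; apply: eq_big_seq => q /Omega_termsP[uq q8 _].
rewrite -set_of_seqS// big_mkcond (bigD1 (set_of_seq q.2))//= big1 ?addr0 => [|I Iq]; last first.
  by rewrite (negbTE Iq) !mulr0 scale0r scaler0; case: ifP.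
case: ifP => // qk; rewrite eqxx mulr1 set_of_seqD -/(residual k q.2) wedge_signE//.
- rewrite (_ : has _ _ = false); last first.
    by apply/hasPn => i; rewrite mem_filter => iq; apply/negP => /andP[/negP].
  rewrite !scalerA; congr (_ *: _).
  by rewrite !signr_addb !signr_odd; ring.
- by rewrite filter_uniq.
- by apply/allP => i; rewrite mem_filter => /andP[_ ik]; exact: (allP c8 _ ik).
Qed.

Lemma starOmega_degree2 V (w : Defs.form V) : of_degree 2 w -> of_degree 2 (starOmega w).
Proof.
move=> w2 K K2; rewrite ffunE ffunE big1 ?scaler0// => I IK.
rewrite Omega0E.
have [I4|I4] := eqVneq #|I| 4%N; last first.
  rewrite big_seq big1 ?mulr0 ?scale0r// => q /Omega_termsP[uq q8 qs].
  case: eqP => [E|]; last by rewrite mulr0.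
  by move: I4; rewrite E card_set_of_seq// qs.
rewrite w2 ?scaler0//; apply: contra K2 => /eqP.
rewrite finset.cardsD (finset.setIidPr IK) I4 => D2.
have := cardsC K; rewrite card_ord => C8.
have := subset_leq_card IK; rewrite I4 => /subnKC.
by rewrite D2 => E; apply/eqP; apply: (@addIn #|~: K|); rewrite C8 -E.
Qed.
End Omega.

(** * Linear identities checked by computation *)

Section LinearForms.
Variable V : zmodType.

(* A list of signed indices stands for a linear form with integer coefficients. *)
Definition ev (I : Type) (w : I -> V) (L : seq (bool * I)) : V :=
  \sum_(q <- L) (if q.1 then - w q.2 else w q.2).
Definition pos (I : Type) (L : seq (bool * I)) := [seq q.2 | q <- L & ~~ q.1].
Definition neg (I : Type) (L : seq (bool * I)) := [seq q.2 | q <- L & q.1].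
Definition sgnL (I : Type) (b : bool) (L : seq (bool * I)) := [seq (b (+) q.1, q.2) | q <- L].
(** Substitution of linear forms into a linear form, which encodes the composition of operators. *)
Definition bind (I J : Type) (L : seq (bool * I)) (M : I -> seq (bool * J)) :=
  flatten [seq sgnL q.1 (M q.2) | q <- L].
(** Negative terms are moved to the other side, so that an identity with integer coefficients
    becomes an equality of two multisets. It is decided by computation on indices, once for all
    groups of values. *)
Definition eqL (I : eqType) (L1 L2 : seq (bool * I)) :=
  perm_eq (pos L1 ++ neg L2) (pos L2 ++ neg L1).

Lemma ev_pos_neg (I : Type) (w : I -> V) L : ev w L = \sum_(i <- pos L) w i - \sum_(i <- neg L) w i.
Proof.
rewrite /ev /pos /neg; elim: L => [|[[] i] L IH] /=; rewrite ?big_nil ?big_cons ?subr0//= IH.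
  by rewrite opprD addrCA.
by rewrite addrA.
Qed.

Lemma ev_eqL (I : eqType) (w : I -> V) L1 L2 : eqL L1 L2 -> ev w L1 = ev w L2.
Proof.
move=> p; rewrite !ev_pos_neg; apply/eqP; rewrite subr_eq addrAC eq_sym subr_eq -!big_cat /=.
by apply/eqP/perm_big; rewrite perm_sym.
Qed.

Lemma ev_cat (I : Type) (w : I -> V) L1 L2 : ev w (L1 ++ L2) = ev w L1 + ev w L2.
Proof. exact: big_cat. Qed.

Lemma ev_sgnL (I : Type) (w : I -> V) b L : ev w (sgnL b L) = if b then - ev w L else ev w L.
Proof.
rewrite /ev big_map; case: b => //; rewrite -sumrN; apply: eq_bigr => -[[] i] _ //=.
by rewrite opprK.
Qed.

Lemma ev_bind (I J : Type) (w : J -> V) L (M : I -> seq (bool * J)) :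
  ev w (bind L M) = ev (fun i => ev w (M i)) L.
Proof.
rewrite /bind [RHS]/ev -[LHS]/(\big[+%R/0]_(q <- _) _).
rewrite big_flatten big_map; apply: eq_bigr => q _; rewrite -[LHS]/(ev w _).
by rewrite ev_sgnL.
Qed.

End LinearForms.

(** Phrased so that [apply] turns a claim about all members of a closed list into one boolean that
    [vm_compute] evaluates. *)
Lemma all_mem (I : eqType) (s : seq I) (P : I -> bool) :
  all P s -> forall k, k \in s -> P k.
Proof. exact: allP. Qed.

(** Component k of w + *(Omega0 /\ w), four times the projection of w to Lambda^2_7; leaving the 1/4
    outside keeps the coefficients integral. *)
Definition dirac_terms k := (false, k) :: starOmega_terms k.

Section PairIdentities.

(* A form in Lambda^2_7 is determined by its components (0, g), 1 <= g <= 7: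
   the component k is, up to the sign (rep27 k).1, the one at (0, (rep27 k).2). *)
Definition rep27 (k : seq nat) : bool * nat :=
  head (false, 0%N) (flatten [seq [seq (q.1, g) | q <- dirac_terms [:: 0%N; g] & q.2 == k] | g <- iota 1 7]).

Lemma starOmega_terms_pairs k q : k \in pairs -> q \in starOmega_terms k -> q.2 \in pairs.
Proof.
move=> kp; move: q; apply: all_mem; move: k kp; by apply: all_mem; vm_compute.
Qed.

(** The relation T^2 = 2 T + 3 for T = *(Omega0 /\ .) on 2-forms. It says that T has eigenvalues 3
    and -1, hence that (1 + T) / 4 maps onto the eigenvalue 3. *)
Lemma starOmega_terms_sqr k : k \in pairs ->
  eqL (bind (starOmega_terms k) starOmega_terms)
    (starOmega_terms k ++ starOmega_terms k ++ nseq 3 (false, k)).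
Proof. by move: k; apply: all_mem; vm_compute. Qed.

(** The monomials of [Omega0] containing 0 are {0} joined to the lines of a Fano plane on 1..7. A
    pair without 0 lies on exactly one line {a, b, g}, so the seven rows of [[:: 0; g]] share out
    the 28 pairs, four to each, and pairs in one class have the same row up to sign. *)
Lemma dirac_terms_rep k : k \in pairs ->
  eqL (dirac_terms k) (sgnL (rep27 k).1 (dirac_terms [:: 0%N; (rep27 k).2])).
Proof. by move: k; apply: all_mem; vm_compute. Qed.

Lemma rep27_pairs k : k \in pairs -> [:: 0%N; (rep27 k).2] \in pairs.
Proof. by move: k; apply: all_mem; vm_compute. Qed.

(** Symmetry of *(Omega0 /\ .) as a matrix. An index (k, l) stands for a product of component k of
    one form with component l of another, so that a bilinear identity is checked as a linear one. *)
Lemma starOmega_terms_sym :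
  eqL (bind [seq (false, k) | k <- pairs] (fun k => [seq (q.1, (k, q.2)) | q <- starOmega_terms k]))
      (bind [seq (false, k) | k <- pairs] (fun k => [seq (q.1, (q.2, k)) | q <- starOmega_terms k])).
Proof. by vm_compute. Qed.

(* (i, j, g) stands for the second derivative d_i d_j of the g-th function. *)
Definition srt (i j g : nat) := (minn i j, maxn i j, g).

(* sum_m d_i d_m u_(m n) for the 2-form u in Lambda^2_7 with components u_(0 g) *)
Definition divL (i n : nat) : seq (bool * (nat * nat * nat)) :=
  flatten [seq if m == n then [::] else
     if (m < n)%N then [:: ((rep27 [:: m; n]).1, srt i m (rep27 [:: m; n]).2)]
     else [:: (~~ (rep27 [:: n; m]).1, srt i m (rep27 [:: n; m]).2)] | m <- iota 0 8].
Definition lapL (g : nat) : seq (bool * (nat * nat * nat)) := [seq (false, (j, j, g)) | j <- iota 0 8].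
Definition ddivL (k : seq nat) := divL (nth 0%N k 0) (nth 0%N k 1) ++ sgnL true (divL (nth 0%N k 1) (nth 0%N k 0)).

(** D (delta u) = Lap u by components. It holds only on Lambda^2_7, which enters through [rep27]
    inside [divL]; the symmetry of second derivatives enters through [srt]. *)
Lemma dirac_sqr27 k : k \in pairs ->
  eqL (bind (dirac_terms k) ddivL) (sgnL (rep27 k).1 (lapL (rep27 k).2)).
Proof. by move: k; apply: all_mem; vm_compute. Qed.

(* d_n (d a)_k for a 1-form a *)
Definition dextL (n : nat) (k : seq nat) : seq (bool * (nat * nat * nat)) :=
  let i := nth 0%N k 0 in let j := nth 0%N k 1 in
  [:: (false, srt n i j); (true, srt n j i)].

(** Lap a = d (sum_j d_j a_j) + delta (D a) by components. The part of delta (D a) that involves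
    Omega0 pairs its antisymmetric coefficients with symmetric second derivatives and cancels,
    leaving the classical formula for delta d. *)
Lemma dirac_sqr1 i : i \in iota 0 8 ->
  eqL (lapL i) ([seq (false, srt i j j) | j <- iota 0 8] ++
    flatten [seq if k == i then [::] else
       if (k < i)%N then bind (dirac_terms [:: k; i]) (dextL k)
       else sgnL true (bind (dirac_terms [:: i; k]) (dextL k))
     | k <- iota 0 8]).
Proof. by move: i; apply: all_mem; vm_compute. Qed.

End PairIdentities.

(** * The projection onto Lambda^2_7 *)

Section Projection.
Context {R : realType}.
Implicit Type (V : lmodType R).

Definition at_pair V (w : Defs.form V) (k : seq nat) : V := w (set_of_seq k).

Lemma formD V (a b : Defs.form V) K : (a + b) K = a K + b K.
Proof. exact: ffunE. Qed.

Lemma formZ V (c : R) (a : Defs.form V) K : (c *: a) K = c *: a K.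
Proof. exact: ffunE. Qed.

Lemma formN V (a : Defs.form V) K : (- a) K = - a K.
Proof. exact: ffunE. Qed.

Lemma signZ V (b : bool) (v : V) : (-1) ^+ b *: v = if b then - v else v.
Proof. by case: b; rewrite ?expr1 ?expr0 ?scaleN1r ?scale1r. Qed.

Lemma starOmega_pair V (w : Defs.form V) k : k \in pairs ->
  starOmega w (set_of_seq k) = ev (at_pair w) (starOmega_terms k).
Proof.
move=> /pairsP[uk k8 _]; rewrite starOmega_set_of_seq// /ev; apply: eq_bigr => q _; exact: signZ.
Qed.

Lemma starOmega_lin V (c : R) (w w' : Defs.form V) :
  starOmega (c *: w + w') = c *: starOmega w + starOmega w'.
Proof.
apply/ffunP => K; rewrite !ffunE scalerA [c * _]mulrC -scalerA -scalerDr; congr (_ *: _).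
rewrite scaler_sumr -big_split; apply: eq_bigr => I _ /=.
by rewrite !ffunE scalerDr !scalerA [c * _]mulrC.
Qed.

Lemma degree2_eq V (w w' : Defs.form V) : of_degree 2 w -> of_degree 2 w' ->
  (forall k, k \in pairs -> w (set_of_seq k) = w' (set_of_seq k)) -> w = w'.
Proof.
move=> w2 w2' H; apply/ffunP => K.
have [/card2_pairs[k kp ->]|K2] := eqVneq #|K| 2%N; first exact: H.
by rewrite w2 ?w2'.
Qed.

Lemma degree_lin V n (c : R) (w w' : Defs.form V) :
  of_degree n w -> of_degree n w' -> of_degree n (c *: w + w').
Proof. by move=> d d' I nI; rewrite !ffunE d ?d'// scaler0 addr0. Qed.

Lemma degreeZ V n (c : R) (w : Defs.form V) : of_degree n w -> of_degree n (c *: w).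
Proof. by move=> d I nI; rewrite !ffunE d ?scaler0. Qed.

Lemma ev_pairs V (w : Defs.form V) k : k \in pairs ->
  ev (at_pair (starOmega w)) (starOmega_terms k) = ev (at_pair w) (bind (starOmega_terms k) starOmega_terms).
Proof.
move=> kp; rewrite ev_bind /ev; apply: eq_big_seq => q qk.
by rewrite /at_pair starOmega_pair//; exact: starOmega_terms_pairs kp qk.
Qed.

Lemma starOmega_sqr V (w : Defs.form V) : of_degree 2 w ->
  starOmega (starOmega w) = 2%:R *: starOmega w + 3%:R *: w.
Proof.
move=> w2; have Tw2 := starOmega_degree2 w2.
apply: degree2_eq; [exact: starOmega_degree2|by apply: degree_lin => //; exact: degreeZ|].
move=> k kp; rewrite formD !formZ !starOmega_pair// ev_pairs//.
rewrite (ev_eqL _ (starOmega_terms_sqr kp)) !ev_cat addrA scaler_nat mulr2n; congr (_ + _).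
by rewrite /ev !big_cons big_nil /= addr0 scaler_nat mulrS mulr2n.
Qed.

Definition P27 V (w : Defs.form V) : Defs.form V := 4%:R^-1 *: (w + starOmega w).

Lemma P27_Lambda27 V (w : Defs.form V) : of_degree 2 w -> Lambda27 (P27 w).
Proof.
move=> w2; have Tw2 := starOmega_degree2 w2; split.
  by apply: degreeZ; have := degree_lin 1 w2 Tw2; rewrite scale1r.
rewrite /= -/(starOmega _) /P27; have := starOmega_lin 4%:R^-1 (w + starOmega w) 0.
have T0 : starOmega (0 : Defs.form V) = 0.
  by have := starOmega_lin (-1) (0 : Defs.form V) 0; rewrite scaler0 addr0 scaleN1r addNr.
rewrite T0 !addr0 => ->; have := starOmega_lin 1 w (starOmega w); rewrite !scale1r => ->.
rewrite starOmega_sqr// scalerA mulrC -scalerA; congr (_ *: _).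
rewrite [RHS]scalerDr addrA [RHS]addrC; congr (_ + _).
by rewrite !scaler_nat -mulrS.
Qed.

Lemma sum_degree2 V (F : {set 'I_8} -> V) : (forall I : {set 'I_8}, #|I| != 2%N -> F I = 0) ->
  \sum_(I : {set 'I_8}) F I = \sum_(k <- pairs) F (set_of_seq k).
Proof.
move=> F0; rewrite -(big_map set_of_seq predT F) [RHS]big_uniq; last first.
  rewrite map_inj_in_uniq; first by vm_compute.
  move=> k l kp lp E.
  have sp m : m \in pairs -> sorted ltn m by rewrite mem_filter => /andP[].
  apply: (irr_sorted_eq ltn_trans ltnn) => [||i]; [exact: sp|exact: sp|].
  have [_ /allP k8 _] := pairsP kp; have [_ /allP l8 _] := pairsP lp.
  have [i8|i8] := boolP (i < 8)%N.
    by have /finset.setP/(_ (Ordinal i8)) := E; rewrite !inE.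
  by rewrite (contraNF (k8 i) i8) (contraNF (l8 i) i8).
rewrite [RHS]big_mkcond; apply: eq_bigr => I _; case: ifPn => // /mapP nI.
rewrite F0//; apply/negP => /eqP/card2_pairs[k kp E]; apply: nI; by exists k.
Qed.

Lemma form_dot_pairs V (l : Defs.form R^o) (w : Defs.form V) : of_degree 2 l ->
  form_dot l w = \sum_(k <- pairs) l (set_of_seq k) *: w (set_of_seq k).
Proof. by move=> l2; apply: sum_degree2 => I I2; rewrite l2// scale0r. Qed.

Lemma form_dotT V (l : Defs.form R^o) (w : Defs.form V) : of_degree 2 l ->
  form_dot l (starOmega w) = form_dot (starOmega l) w.
Proof.
move=> l2; rewrite !form_dot_pairs//; last exact: starOmega_degree2.
pose W (p : seq nat * seq nat) : V := l (set_of_seq p.1) *: w (set_of_seq p.2).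
have := ev_eqL W starOmega_terms_sym; rewrite !ev_bind /ev !big_map.
have e1 k : k \in pairs -> l (set_of_seq k) *: starOmega w (set_of_seq k) =
    \sum_(q <- [seq (q.1, (k, q.2)) | q <- starOmega_terms k]) (if q.1 then - W q.2 else W q.2).
  move=> kp; rewrite starOmega_pair// /ev scaler_sumr [RHS]big_map; apply: eq_bigr => -[[] q] _ //=.
  by rewrite scalerN.
have e2 k : k \in pairs -> starOmega l (set_of_seq k) *: w (set_of_seq k) =
    \sum_(q <- [seq (q.1, (q.2, k)) | q <- starOmega_terms k]) (if q.1 then - W q.2 else W q.2).
  move=> kp; rewrite starOmega_pair// /ev scaler_suml [RHS]big_map; apply: eq_bigr => -[[] q] _ //=.
  by rewrite scaleNr.
by rewrite (eq_big_seq _ e1) (eq_big_seq _ e2).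
Qed.

Lemma starOmega_coord m n (w : Defs.form 'M[R]_(m, n)) p q K :
  starOmega ([ffun I : {set 'I_8} => w I p q] : Defs.form R^o) K = starOmega w K p q.
Proof.
rewrite !ffunE mxE summxE; congr (_ * _); apply: eq_bigr => I _.
by rewrite !ffunE mxE.
Qed.

(** With T = *(Omega0 /\ .), w - P27 w = (3 w - T w) / 4 is orthogonal to Lambda^2_7 because T is
    symmetric. For uniqueness, each matrix entry of the difference of two candidates is itself a
    form in Lambda^2_7, hence an admissible test form, and testing with it produces a vanishing sum
    of squares. *)
Lemma pi27E m n (w : Defs.form 'M[R]_(m, n)) : of_degree 2 w -> pi27 w = P27 w.
Proof.
move=> w2; have Tw2 := starOmega_degree2 w2; have [P2 PT] := P27_Lambda27 w2.
have Pdot (l : Defs.form R^o) : Lambda27 l -> form_dot l (w - P27 w) = 0.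
  move=> [l2 /= lT]; have dotZ (c : R) (v v' : Defs.form 'M[R]_(m, n)) :
      form_dot l (c *: v + v') = c *: form_dot l v + form_dot l v'.
    rewrite /form_dot scaler_sumr -big_split; apply: eq_bigr => I _ /=.
    by rewrite !ffunE scalerDr !scalerA [c * _]mulrC.
  have -> : w - P27 w = (- 4%:R^-1) *: starOmega w + (3%:R / 4%:R) *: w.
    apply/ffunP => I; rewrite /P27 !(formD, formZ, formN); apply/matrixP => i j; rewrite !mxE.
    by set a := (w I i j); set b := (starOmega w I i j); field.
  have -> : (3%:R / 4%:R) *: w = (3%:R / 4%:R) *: w + 0 by rewrite addr0.
  have d0 : form_dot l (0 : Defs.form 'M[R]_(m, n)) = 0.
    by rewrite /form_dot big1// => I _; rewrite ffunE scaler0.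
  rewrite !dotZ d0 addr0 form_dotT// [starOmega l]lT.
  have -> : form_dot (3%:R *: l) w = 3%:R *: form_dot l w.
    by rewrite /form_dot scaler_sumr; apply: eq_bigr => I _; rewrite ffunE scalerA.
  by rewrite scalerA -scalerDl mulNr [_^-1 * _]mulrC addNr scale0r.
rewrite /pi27; case: xgetP => [e _ [[e2 eT] edot]|/(_ (P27 w))]; last first.
  by move=> H; exfalso; apply: H.
apply/eqP; rewrite -subr_eq0; apply/eqP/ffunP => I; rewrite [RHS]ffunE.
apply/matrixP => i j; rewrite [RHS]mxE.
pose z := e - P27 w; pose l : Defs.form R^o := [ffun I : {set 'I_8} => z I i j].
have z2 : of_degree 2 z by rewrite /z addrC -scaleN1r; exact: (degree_lin (-1) P2 e2).
have zT : starOmega z = 3%:R *: z.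
  rewrite /z [in LHS]addrC -scaleN1r starOmega_lin [starOmega (P27 w)]PT [starOmega e]eT.
  by rewrite !scaleN1r [LHS]addrC scalerBr.
have lL : Lambda27 l.
  split=> [J J2|]; first by rewrite ffunE z2// mxE.
  apply/ffunP => J; by rewrite -[star _]/(starOmega l) starOmega_coord zT [RHS]formZ
    [l J]ffunE [in LHS]formZ mxE.
have lz : form_dot l z = 0.
  have -> : z = (w - P27 w) - (w - e) by rewrite opprB addrC addrA subrK.
  rewrite /form_dot; under eq_bigr do rewrite formD scalerDr.
  rewrite big_split /=; have := Pdot l lL; rewrite /form_dot => ->; rewrite add0r.
  under eq_bigr do rewrite formN scalerN.
  by rewrite sumrN; have := edot l lL; rewrite /form_dot => ->; rewrite oppr0.
have : \sum_(J : {set 'I_8}) l J ^+ 2 = 0.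
  have /matrixP/(_ i j) := lz; rewrite /form_dot summxE [RHS]mxE => lz0; apply: etrans lz0.
  by apply: eq_bigr => J _; rewrite mxE expr2 {2}/l ffunE.
move/eqP; rewrite psumr_eq0; last by move=> J _; exact: sqr_ge0.
by move=> /allP/(_ I (mem_index_enum _)); rewrite /= sqrf_eq0 /l ffunE => /eqP.
Qed.

End Projection.

(** * Smooth 2-periodic functions *)

Section Taylor.
Local Open Scope classical_set_scope.
Local Open Scope ring_scope.
Context {R : realType}.
Notation E := 'rV[R]_8.
Implicit Types (u : E -> R) (x h : E) (i j : 'I_8).

(* [partial] with R as codomain instead of the normed module R, so that
   products and sums of derivatives are those of the field R. *)
Definition pd i u : E -> R := partial i u.

Lemma coord_le_norm (h : E) i : `|h 0 i| <= `|h|.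
Proof.
rewrite [leRHS]/Num.norm/= mx_normrE.
by apply: (@le_bigmax _ _ _ 0 (fun ij : 'I_1 * 'I_8 => `|h ij.1 ij.2|) (0, i)).
Qed.

Lemma derive_sum_partial u x h : differentiable u x ->
  'D_h u x = \sum_(i < 8) h 0 i * pd i u x.
Proof.
move=> du; rewrite deriveE// [h in LHS]row_sum_delta linear_sum.
by apply: eq_bigr => i _; rewrite linearZ /pd /partial deriveE.
Qed.

Lemma is_derive_line u x h (t : R) : differentiable u (x + t *: h) ->
  is_derive t 1 (fun s : R => u (x + s *: h)) (\sum_(i < 8) h 0 i * pd i u (x + t *: h)).
Proof.
move=> du; rewrite -derive_sum_partial//.
have EQ : (fun s : R => s^-1 *: (((fun r : R => u (x + r *: h)) \o shift t) (s *: 1) - u (x + t *: h)))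
   = (fun s : R => s^-1 *: ((u \o shift (x + t *: h)) (s *: h) - u (x + t *: h))).
  by apply/funext => s /=; rewrite [s *: 1]mulr1 scalerDl addrCA addrA.
have Q : derivable (fun s : R => u (x + s *: h)) t 1.
  by have := diff_derivable (v := h) du; rewrite /derivable EQ.
by apply: DeriveDef => //; rewrite /derive EQ.
Qed.

Lemma MVT_line u x h : (forall y, differentiable u y) ->
  exists2 c : R, c \in `[0, 1] &
    u (x + h) - u x = \sum_(i < 8) h 0 i * pd i u (x + c *: h).
Proof.
move=> du.
have [|c cI] := @MVT_segment R (fun t => u (x + t *: h))
   (fun t => \sum_(i < 8) h 0 i * pd i u (x + t *: h)) 0 1 ler01 (fun t _ => is_derive_line (du _)).
  apply: derivable_within_continuous => t _.
  exact: (ex_derive (is_derive := is_derive_line (du _))).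
by rewrite scale1r scale0r addr0 subr0 mulr1 => H; exists c.
Qed.

Lemma lipschitz_partial u (K : R) : (forall y, differentiable u y) ->
  (forall i y, `|pd i u y| <= K) ->
  forall x h, `|u (x + h) - u x| <= 8%:R * K * `|h|.
Proof.
move=> du uK x h; have [c _ ->] := MVT_line x h du.
apply: le_trans (ler_norm_sum _ _ _) _.
have -> : 8%:R * K * `|h| = \sum_(i < 8) K * `|h|.
  by rewrite sumr_const card_ord -mulrA mulr_natl.
apply: ler_sum => i _.
by rewrite normrM mulrC ler_pM// coord_le_norm.
Qed.

Lemma taylor_partial u (K : R) : (forall y, differentiable u y) ->
  (forall i y, differentiable (pd i u) y) ->
  (forall i j y, `|pd j (pd i u) y| <= K) ->
  forall x h, `|u (x + h) - u x - \sum_(i < 8) h 0 i * pd i u x|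
    <= 64%:R * K * `|h| ^+ 2.
Proof.
move=> du ddu uK x h; have [c cI ->] := MVT_line x h du.
rewrite -sumrB; apply: le_trans (ler_norm_sum _ _ _) _.
have -> : 64%:R * K * `|h| ^+ 2 = \sum_(i < 8) `|h| * (8%:R * K * `|h|).
  by rewrite sumr_const card_ord -mulr_natl; ring.
have K0 : 0 <= K by exact: le_trans (normr_ge0 _) (uK ord0 ord0 0).
apply: ler_sum => i _; rewrite -mulrBr normrM ler_pM// ?coord_le_norm//.
apply: le_trans (lipschitz_partial (ddu i) (uK i) x (c *: h)) _.
rewrite normrZ ler_wpM2l ?mulr_ge0//.
move: cI; rewrite in_itv/= => /andP[c0 c1].
by rewrite (ger0_norm c0) ler_piMl.
Qed.

(** A criterion for functions whose derivatives are known in advance but whose differentiability is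
    not: a quadratic error for the candidate [du] at the single point x suffices. *)
Lemma taylor_differentiable (V : normedModType R) (u : E -> V) (du : 'I_8 -> E -> V) (C : R) x :
  (forall h, `|u (x + h) - u x - \sum_(i < 8) h 0 i *: du i x| <= C * `|h| ^+ 2) ->
  differentiable u x /\ forall i, partial i u x = du i x.
Proof.
move=> uC.
pose L (h : E) : V := \sum_(i < 8) h 0 i *: du i x.
have Llin : linear L.
  move=> a v w; rewrite /L scaler_sumr -big_split; apply: eq_bigr => i _ /=.
  by rewrite !mxE scalerDl scalerA.
pose LL : {linear E -> V} := HB.pack L (GRing.isLinear.Build _ _ _ _ L Llin).
have Lc : continuous LL.
  apply/linear_bounded_continuous/bounded_funP => r.
  exists (\sum_(i < 8) r * `|du i x|) => v vr.
  apply: le_trans (ler_norm_sum _ _ _) _; apply: ler_sum => i _.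
  by rewrite normrZ ler_wpM2r// (le_trans (coord_le_norm _ _)).
have HO : u \o shift x = cst (u x) + LL +o_ (0 : E) id.
  apply/eqaddoP => e e0.
  have C1 : 0 < `|C| + 1 by rewrite ltr_wpDl.
  near=> h; rewrite /= -[(_ - _) h]/(u (h + x) - (u x + L h)) opprD addrA addrC.
  rewrite [h + x]addrC addrC.
  apply: le_trans (uC h) _; rewrite expr2 mulrA ler_wpM2r//.
  have : `|h| <= e / (`|C| + 1).
    near: h; exact: (@nbhs0_le R E (e / (`|C| + 1)) (divr_gt0 e0 C1)).
  rewrite ler_pdivlMr// => H; apply: le_trans H; rewrite mulrC ler_wpM2l//.
  by rewrite (le_trans (ler_norm C))// lerDl.
have D : differentiable u x.
  apply/diffP => /=.
  (* The differential is defined by choice among the linear maps with the required expansion, so it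
     is enough to exhibit [LL]. *)
  apply: (@getPex _ (fun (df : {linear E -> V}) => continuous df /\
    forall y, u y = u (lim (nbhs x)) + df (y - lim (nbhs x))
                  +o_(y \near x) (y - lim (nbhs x)))).
  exists LL; split=> //; apply: eqaddoEx => z.
  have HOx h : u (h + x) = u x + LL h +o_(h \near (0 : E)) h.
    by have /(congr1 (fun f => f h)) := HO.
  rewrite lim_id// -[in LHS](subrK x z) HOx; congr (_ + _).
  rewrite -(comp_centerK x id) -[X in the_littleo _ _ _ X](comp_centerK x).
  by rewrite -[_ (z - x)]/((_ \o (center x)) z) -littleo_center0.
split=> // i.
rewrite /partial deriveE// (diff_unique Lc HO) /= /L (bigD1 i)//= big1 => [|j ji].
  by rewrite mxE !eqxx scale1r addr0.
by rewrite mxE eqxx (negbTE ji) scale0r.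
Unshelve. all: by end_near. Qed.
End Taylor.

(** * Signed affine maps and functions of period 2 *)

Section Periodic.
Local Open Scope classical_set_scope.
Local Open Scope ring_scope.
Context {R : realType}.
Notation E := 'rV[R]_8.
Implicit Types (u v : E -> R) (x h : E) (i j : 'I_8) (s : seq 'I_8).

(** The shape of every element of the orbifold group, by [pi1orb_saff]: [b] marks the reflected
    coordinates, and translations are the case where no coordinate is reflected. *)
Definition saff (b : 'I_8 -> bool) (t x : E) : E :=
  \row_(i < 8) ((-1) ^+ b i * x 0 i + t 0 i).

Lemma saffD b t x (a : R) i :
  saff b t (x + a *: delta_mx 0 i) = saff b t x + (a * (-1) ^+ b i) *: delta_mx 0 i.
Proof.
apply/rowP => j; rewrite !mxE eqxx/=; have [->|] := eqVneq j i.
  by rewrite !mulr1 /=; ring.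
by rewrite !mulr0 !addr0.
Qed.

Lemma saff_shift h x : saff (fun=> false) h x = x + h.
Proof. by apply/rowP => j; rewrite !mxE mul1r. Qed.

Lemma partial_saff u b t i x : differentiable u (saff b t x) ->
  pd i (fun y => u (saff b t y)) x = (-1) ^+ b i * pd i u (saff b t x).
Proof.
move=> du.
transitivity ('D_((-1) ^+ b i *: delta_mx 0 i) u (saff b t x)).
  rewrite /pd /partial /derive; set F := fun r => _; set G := fun r => _.
  suff -> : F = G by [].
  by apply/funext => r; rewrite /F /G /= [_ + x]addrC saffD scalerA [_ + saff _ _ _]addrC.
by rewrite !deriveE// linearZ /pd /partial deriveE.
Qed.

Lemma partial_lin (a : R) u v i x : differentiable u x -> differentiable v x ->
  pd i (fun y => a * u y + v y) x = a * pd i u x + pd i v x.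
Proof.
move=> du dv; rewrite /pd.
rewrite (_ : (fun y => _) = (a \*: u) + v)//.
have Du := diff_derivable (v := delta_mx 0 i : E) du.
have Dv := diff_derivable (v := delta_mx 0 i : E) dv.
by rewrite [LHS](deriveD (derivableZ (k := a) Du) Dv) (deriveZ a Du).
Qed.

Lemma foldr_partial_lin (a : R) u v s : smooth u -> smooth v ->
  foldr pd (fun y => a * u y + v y) s =
  (fun y => a * foldr pd u s y + foldr pd v s y).
Proof.
move=> su sv; elim: s => //= i s ->; apply/funext => x.
exact: partial_lin (su s x) (sv s x).
Qed.

Lemma smooth_lin (a : R) u v : smooth u -> smooth v -> smooth (fun y => a * u y + v y).
Proof.
move=> su sv s x; rewrite foldr_partial_lin//.
rewrite (_ : (fun y => _) = (a \*: foldr pd u s) + foldr pd v s)//.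
by apply: differentiableD; [apply: differentiableZ; exact: su | exact: sv].
Qed.

Lemma smooth_partial u i : smooth u -> smooth (pd i u).
Proof. by move=> su s x; have := su (rcons s i) x; rewrite foldr_rcons. Qed.

Lemma smooth_diff u x : smooth u -> differentiable u x.
Proof. by move=> /(_ [::] x). Qed.

Lemma saff_taylor b t x : differentiable (saff b t) x /\
  forall i, partial i (saff b t) x = (-1) ^+ b i *: delta_mx 0 i.
Proof.
apply: (@taylor_differentiable R _ (saff b t) (fun i _ => (-1) ^+ b i *: delta_mx 0 i) 0).
move=> h; rewrite mul0r normr_le0; apply/eqP/rowP => j; rewrite !mxE summxE.
rewrite (bigD1 j)//= big1 => [|i ij]; last by rewrite !mxE eq_sym (negbTE ij) andbF !mulr0.
rewrite !mxE !eqxx/=; ring.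
Qed.

Lemma saff_differentiable b t x : differentiable (saff b t) x.
Proof. by have [] := saff_taylor b t x. Qed.

Lemma foldr_partial_saff u b t s : smooth u ->
  foldr pd (fun y => u (saff b t y)) s =
  (fun y => (\prod_(i <- s) (-1) ^+ b i) * foldr pd u s (saff b t y)).
Proof.
move=> su; elim: s => [|i s /= ->]; first by apply/funext => y; rewrite big_nil mul1r.
have H z : differentiable (fun y => foldr pd u s (saff b t y)) z.
  by apply: differentiable_comp; [exact: saff_differentiable|exact: su].
apply/funext => x; rewrite big_cons -mulrA mulrCA -(partial_saff _ (su s _)).
have := partial_lin (\prod_(i <- s) (-1) ^+ b i) i (H x) (@differentiable_cst _ _ _ (0:R) x).
rewrite [X in _ + X]derive_cst addr0 => <-.
by congr pd; apply/funext => y; rewrite addr0.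
Qed.

Lemma smooth_saff u b t : smooth u -> smooth (fun y => u (saff b t y)).
Proof.
move=> su s x; rewrite foldr_partial_saff//.
rewrite (_ : (fun y => _) = (\prod_(i <- s) (-1) ^+ b i) \*: (foldr pd u s \o saff b t))//.
apply: differentiableZ.
by apply: differentiable_comp; [exact: saff_differentiable|exact: su].
Qed.

Definition psmooth u := smooth u /\ forall i x, u (x + 2%:R *: delta_mx 0 i) = u x.

Lemma psmooth_lin (a : R) u v : psmooth u -> psmooth v -> psmooth (fun y => a * u y + v y).
Proof.
move=> [su pu] [sv pv]; split; first exact: smooth_lin.
by move=> i x; rewrite pu pv.
Qed.

Lemma psmooth_cst (c : R) : psmooth (fun=> c).
Proof.
split=> // s x; rewrite (_ : foldr _ _ s = cst (if s is [::] then c else 0)).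
  exact: differentiable_cst.
elim: s => //= i s ->; apply/funext => y.
by rewrite /partial derive_cst.
Qed.

Lemma psmooth0 : psmooth (fun=> 0).
Proof. exact: psmooth_cst. Qed.

Lemma psmoothZ (a : R) u : psmooth u -> psmooth (fun y => a * u y).
Proof.
move=> pu; have := psmooth_lin a pu psmooth0.
by congr psmooth; apply/funext => y; rewrite addr0.
Qed.

Lemma psmoothD u v : psmooth u -> psmooth v -> psmooth (fun y => u y + v y).
Proof.
move=> pu pv; have := psmooth_lin 1 pu pv.
by congr psmooth; apply/funext => y; rewrite mul1r.
Qed.

Lemma psmoothB u v : psmooth u -> psmooth v -> psmooth (fun y => u y - v y).
Proof.
move=> pu pv; have := psmooth_lin (-1) pv pu.
by congr psmooth; apply/funext => y; rewrite mulN1r addrC.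
Qed.

Lemma psmooth_sum (I : Type) (r : seq I) (F : I -> E -> R) :
  (forall k, psmooth (F k)) -> psmooth (fun y => \sum_(k <- r) F k y).
Proof.
move=> pF; elim: r => [|k r IH].
  by have := psmooth0; congr psmooth; apply/funext => y; rewrite big_nil.
have := psmoothD (pF k) IH.
by congr psmooth; apply/funext => y; rewrite big_cons.
Qed.

Lemma period_opp u x (p : E) : (forall y, u (y + p) = u y) -> u (x - p) = u x.
Proof. by move=> H; rewrite -(H (x - p)) subrK. Qed.

Lemma psmooth_saff u b t : psmooth u -> psmooth (fun y => u (saff b t y)).
Proof.
move=> [su pu]; split; first exact: smooth_saff.
move=> i x; rewrite saffD; case: (b i); last by rewrite mulr1.
by rewrite expr1 mulrN1 scaleNr (period_opp _ (pu i)).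
Qed.

Lemma psmooth_shift u h : psmooth u -> psmooth (fun y => u (y + h)).
Proof.
move=> pu; have := psmooth_saff (fun=> false) h pu.
by congr psmooth; apply/funext => y; rewrite saff_shift.
Qed.

Lemma partial_shift u h i x : pd i (fun y => u (y + h)) x = pd i u (x + h).
Proof.
rewrite /pd /partial /derive; set F := fun r => _; set G := fun r => _.
suff -> : F = G by [].
by apply/funext => r; rewrite /F /G /= addrA.
Qed.

Lemma psmooth_partial u i : psmooth u -> psmooth (pd i u).
Proof.
move=> [su pu]; split; first exact: smooth_partial.
move=> j x; rewrite -partial_shift; congr (pd i _ x).
by apply/funext => y.
Qed.

Lemma psmooth_foldr u s : psmooth u -> psmooth (foldr pd u s).
Proof. by move=> pu; elim: s => //= i s; exact: psmooth_partial. Qed.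

Lemma psmooth_bounded u : psmooth u -> exists K, forall x, `|u x| <= K.
Proof.
move=> [su pu].
pose A := [set x : E | forall i, [set` `[0, 2%:R]] (x 0 i)].
have cA : compact A by apply: (@rV_compact R 8 (fun=> [set` `[0, 2%:R]])) => _; exact: segment_compact.
have A0 : A !=set0 by exists 0 => i /=; rewrite mxE in_itv/= lexx ler0n.
have cu : {within A, continuous (fun x => `|u x|)}.
  apply: continuous_subspaceT => x; apply: (@continuous_comp _ _ _ u Num.norm).
    exact/differentiable_continuous/smooth_diff.
  exact: norm_continuous.
have [c cA1 cM] := EVT_max_rV A0 cA cu.
exists `|u c| => x.
have per (k : 'I_8 -> int) y : u (y + \sum_(i < 8) (2%:R *: delta_mx 0 i) *~ k i) = u y.
  elim/big_rec: _ y => [y|i z _ IH y]; first by rewrite addr0.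
  rewrite addrA IH.
  have pn n w : u (w + (2%:R *: delta_mx 0 i) *+ n) = u w.
    elim: n w => [|n IHn] w; first by rewrite addr0.
    by rewrite mulrS addrA IHn pu.
  case: (k i) => n; first exact: pn.
  rewrite NegzE mulrNz; apply: period_opp => w; exact: pn.
have ent (k : int) (l j : 'I_8) : ((2%:R *: delta_mx 0 l) *~ k : E) 0 j = k%:~R * (2%:R * (j == l)%:R).
  by rewrite -[_ *~ k]scaler_int !mxE eqxx.
(* Translating by these multiples of the period brings every coordinate into [0, 2]. *)
rewrite -(per (fun i => - Num.floor (x 0 i / 2%:R))).
apply: cM; rewrite inE => i /=; rewrite mxE summxE (bigD1 i)//= big1 => [|j ji].
  have := floor_itv (x 0 i / 2%:R); move=> /andP[].
  rewrite in_itv/= addr0 ent eqxx mulr1 mulrNz.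
  rewrite intrD; set f := _%:~R; lra.
by rewrite ent eq_sym (negbTE ji) !mulr0.
Qed.

End Periodic.

(** * Bounded translation-invariant operators *)

Section GoodOp.
Local Open Scope classical_set_scope.
Local Open Scope ring_scope.
Context {R : realType}.
Notation E := 'rV[R]_8.
Implicit Types (u v w : E -> R) (x h : E) (i j : 'I_8) (s : seq 'I_8).

Lemma norm_delta_le1 i : `|delta_mx 0 i : E| <= 1.
Proof.
rewrite [leLHS]/Num.norm/= mx_normrE; apply: bigmax_le => // -[a b] _ /=.
by rewrite mxE; case: (_ && _); rewrite ?normr1 ?normr0.
Qed.

Lemma sum_delta (a : R) i (F : 'I_8 -> R) :
  \sum_(k < 8) (a *: delta_mx 0 i : E) 0 k * F k = a * F i.
Proof.
rewrite (bigD1 i)//= big1 => [|k ki]; last by rewrite !mxE eqxx (negbTE ki) mulr0 mul0r.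
by rewrite !mxE !eqxx mulr1 addr0.
Qed.

(** The mean value theorem is applied along e_i to the difference in direction e_j, then along e_j.
    The intermediate point depends on this order, so only its distance to x is recorded. *)
Lemma second_difference u (a : R) x i j : smooth u -> 0 < a -> exists2 p : E, `|p| <= 2%:R * a &
  u (x + a *: delta_mx 0 i + a *: delta_mx 0 j) - u (x + a *: delta_mx 0 i)
  - (u (x + a *: delta_mx 0 j) - u x) = a ^+ 2 * pd j (pd i u) (x + p).
Proof.
move=> su a0.
pose g y := u (y + a *: delta_mx 0 j) - u y.
have sg : smooth g.
  have s1 : smooth (fun y => u (y + a *: delta_mx 0 j)).
    have := smooth_saff (fun=> false) (a *: delta_mx 0 j) su.
    by congr smooth; apply/funext => y; rewrite saff_shift.
  have := smooth_lin (-1) su s1.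
  by congr smooth; apply/funext => y; rewrite mulN1r addrC.
have [c cI gE] := MVT_line x (a *: delta_mx 0 i) (fun y => smooth_diff y sg).
move: gE; rewrite sum_delta; set z := x + c *: _.
have -> : pd i g z = pd i u (z + a *: delta_mx 0 j) - pd i u z.
  rewrite -[in RHS]partial_shift.
  have d1 y : differentiable (fun y => u (y + a *: delta_mx 0 j)) y.
    have := smooth_diff y (smooth_saff (fun=> false) (a *: delta_mx 0 j) su).
    by under [in X in X -> _]eq_fun do rewrite saff_shift.
  have := partial_lin (-1) i (smooth_diff z su) (d1 z).
  rewrite mulN1r [in X in _ -> X]addrC => <-; congr (pd i _ z).
  by apply/funext => y; rewrite mulN1r addrC.
have [d dI ->] /= := MVT_line z (a *: delta_mx 0 j) (fun y => smooth_diff y (smooth_partial i su)).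
rewrite sum_delta mulrA -expr2 /z => gE.
exists (c *: (a *: delta_mx 0 i) + d *: (a *: delta_mx 0 j)); last by rewrite [x + (_ + _)]addrA; exact: gE.
have bd (e : R) k : e \in `[0, 1] -> `|e *: (a *: delta_mx 0 k) : E| <= a.
  rewrite in_itv/= => /andP[e0 e1].
  rewrite !normrZ (ger0_norm e0) (gtr0_norm a0) mulrCA ler_piMr ?(ltW a0)//.
  by rewrite mulr_ile1 ?norm_delta_le1.
by rewrite (le_trans (ler_normD _ _))// mulr_natl mulr2n lerD ?bd.
Qed.

(** The second difference is symmetric in i and j, so the two mixed derivatives agree at two points
    within 2 a of x. Third derivatives are bounded by periodicity, which makes the discrepancy at x
    at most a constant times a, for every a > 0. *)
Lemma clairaut u i j : psmooth u -> pd i (pd j u) = pd j (pd i u).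
Proof.
move=> pu; have su := pu.1; apply/funext => x.
have [K1 HK1] : exists K, forall k y, `|pd k (pd i (pd j u)) y| <= K.
  have /choice[f Hf] : forall k, exists K, forall y, `|pd k (pd i (pd j u)) y| <= K.
    by move=> k; apply: psmooth_bounded; do 3 apply: psmooth_partial.
  exists (\sum_k `|f k|) => k y; apply: le_trans (Hf k y) _.
  by rewrite (bigD1 k)//= (le_trans (ler_norm _))// lerDl sumr_ge0.
have [K2 HK2] : exists K, forall k y, `|pd k (pd j (pd i u)) y| <= K.
  have /choice[f Hf] : forall k, exists K, forall y, `|pd k (pd j (pd i u)) y| <= K.
    by move=> k; apply: psmooth_bounded; do 3 apply: psmooth_partial.
  exists (\sum_k `|f k|) => k y; apply: le_trans (Hf k y) _.
  by rewrite (bigD1 k)//= (le_trans (ler_norm _))// lerDl sumr_ge0.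
have K10 : 0 <= K1 by exact: le_trans (normr_ge0 _) (HK1 ord0 0).
have K20 : 0 <= K2 by exact: le_trans (normr_ge0 _) (HK2 ord0 0).
have L1 := lipschitz_partial (fun y => smooth_diff y (psmooth_partial i (psmooth_partial j pu)).1) HK1.
have L2 := lipschitz_partial (fun y => smooth_diff y (psmooth_partial j (psmooth_partial i pu)).1) HK2.
suff H (a : R) : 0 < a -> `|pd i (pd j u) x - pd j (pd i u) x| <= 16%:R * (K1 + K2) * a.
  apply/eqP; rewrite -subr_eq0 -normr_le0; apply/ler_addgt0Pr => e e0; rewrite add0r.
  have C0 : 0 < 16%:R * (K1 + K2) + 1 by lra.
  apply: le_trans (H (e / (16%:R * (K1 + K2) + 1)) (divr_gt0 e0 C0)) _.
  rewrite mulrA ler_pdivrMr// mulrC ler_wpM2l//; [exact: ltW | lra].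
move=> a0.
have [p pa Ep] := second_difference x i j su a0.
have [q qa Eq] := second_difference x j i su a0.
have pq : pd j (pd i u) (x + p) = pd i (pd j u) (x + q).
  apply: (@mulfI _ (a ^+ 2)); first by rewrite expf_neq0// gt_eqF.
  have AC (A B C D : R) : A - B - (C - D) = A - C - (B - D) by ring.
  apply: etrans (esym Ep) _; apply: etrans _ Eq.
  by rewrite [x + _ + a *: delta_mx 0 j]addrAC; exact: AC.
have := L1 x q; have := L2 x p; rewrite pq.
move: (pd i _ x) (pd j _ x) (pd i _ _) => A B D H1 H2.
have -> : A - B = (D - B) - (D - A) by ring.
apply: le_trans (ler_normB _ _) _; apply: le_trans (lerD H1 H2) _.
have : K2 * `|p| <= K2 * (2%:R * a) by rewrite ler_wpM2l.
have : K1 * `|q| <= K1 * (2%:R * a) by rewrite ler_wpM2l.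
move: K20 K10 a0 {pa qa L1 L2 HK1 HK2 H1 H2 pq Ep Eq}.
move: `|p| `|q| => P Q *; nra.
Qed.

(** The C^N norm of u is at most K. *)
Definition bnd (N : nat) (K : R) u := forall s, (size s <= N)%N -> forall x, `|foldr pd u s x| <= K.

Lemma bnd_ge0 N K u : bnd N K u -> 0 <= K.
Proof. by move=> /(_ [::] isT 0); exact: le_trans. Qed.

Lemma bndW N M K u : (N <= M)%N -> bnd M K u -> bnd N K u.
Proof. by move=> NM b s sN; apply: b; exact: leq_trans NM. Qed.

Lemma bnd_partial N K u i : bnd N.+1 K u -> bnd N K (pd i u).
Proof. by move=> b s sN x; rewrite -foldr_rcons; apply: b; rewrite size_rcons. Qed.

Lemma bnd_foldr N K u s : bnd (N + size s) K u -> bnd N K (foldr pd u s).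
Proof.
move=> b s' s'N x; rewrite -foldr_cat; apply: b.
by rewrite size_cat leq_add2r.
Qed.

Lemma bnd_exists N u : psmooth u -> exists K, bnd N K u.
Proof.
elim: N u => [|N IH] u pu; have [K0 HK0] := psmooth_bounded pu.
  by exists K0 => -[].
have /choice[f Hf] : forall i, exists K, bnd N K (pd i u).
  by move=> i; apply: IH; exact: psmooth_partial.
exists (`|K0| + \sum_i `|f i|) => s; case/lastP: s => [_ x|s i].
  by rewrite (le_trans (HK0 x))// (le_trans (ler_norm _))// lerDl sumr_ge0.
rewrite size_rcons ltnS => sN x; rewrite foldr_rcons; apply: le_trans (Hf i s sN x) _.
by rewrite (bigD1 i)//= (le_trans (ler_norm _))// addrCA lerDl addr_ge0// sumr_ge0.
Qed.

Definition remainder u h x := u (x + h) - u x - \sum_(i < 8) h 0 i * pd i u x.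

Lemma psmooth_remainder u h : psmooth u -> psmooth (remainder u h).
Proof.
move=> pu; apply: psmoothB; first by apply: psmoothB => //; exact: psmooth_shift.
by apply: psmooth_sum => i; apply: psmoothZ; exact: psmooth_partial.
Qed.

Lemma partial_sum (I : Type) (r : seq I) (F : I -> E -> R) (c : I -> R) i x :
  (forall k y, differentiable (F k) y) ->
  pd i (fun y => \sum_(k <- r) c k * F k y) x = \sum_(k <- r) c k * pd i (F k) x.
Proof.
move=> dF.
elim: r => [|k r IH].
  rewrite big_nil (_ : (fun y => _) = cst 0) ?/pd ?/partial ?derive_cst//.
  by apply/funext => y; rewrite big_nil.
rewrite big_cons -IH -partial_lin//.
  by congr (pd i _ x); apply/funext => y; rewrite big_cons.
move=> {IH}; elim: r => [|l r IH].
  rewrite (_ : (fun y => _) = cst 0); first exact: differentiable_cst.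
  by apply/funext => y; rewrite big_nil.
rewrite (_ : (fun y => _) = (c l \*: F l) + (fun y => \sum_(j <- r) c j * F j y)).
  by apply: differentiableD => //; exact: differentiableZ.
by apply/funext => y; rewrite big_cons.
Qed.

Lemma foldr_remainder u h s : psmooth u ->
  foldr pd (remainder u h) s = remainder (foldr pd u s) h.
Proof.
move=> pu; elim: s => //= i s ->; apply/funext => x.
have pw := psmooth_foldr s pu; move: (foldr _ _ _) pw => w pw {s}.
have d1 := smooth_diff x pw.1.
have d2 := smooth_diff x (psmooth_shift h pw).1.
have ps : psmooth (fun y => \sum_(k < 8) h 0 k * pd k w y).
  by apply: psmooth_sum => k; apply: psmoothZ; exact: psmooth_partial.
have d3 := smooth_diff x ps.1.
have -> : remainder w h = fun y => -1 * (\sum_(k < 8) h 0 k * pd k w y) +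
   (-1 * w y + w (y + h)).
  by apply/funext => y; rewrite /remainder; ring.
rewrite partial_lin//; last first.
  exact: smooth_diff (psmooth_lin (-1) pw (psmooth_shift h pw)).1.
rewrite partial_lin// partial_shift partial_sum; last first.
  by move=> k y; exact: smooth_diff (psmooth_partial k pw).1.
have AR (a b c : R) : -1 * a + (-1 * b + c) = c - b - a by ring.
rewrite /remainder AR; apply: (congr1 (fun z => pd i w (x + h) - pd i w x - z)).
by apply: eq_bigr => k _; have EE := clairaut i k pw; rewrite EE.
Qed.

(** Taking the remainder commutes with derivatives, by [clairaut], so Taylor's estimate for each
    derivative of u gives O(|h|^2) in every C^N norm and not only pointwise. *)
Lemma bnd_remainder N u : psmooth u ->
  exists2 C, 0 <= C & forall h, bnd N (C * `|h| ^+ 2) (remainder u h).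
Proof.
move=> pu; have [K HK] := bnd_exists N.+2 pu.
exists (64%:R * K); first by rewrite mulr_ge0// (bnd_ge0 HK).
move=> h s sN x; rewrite foldr_remainder//.
have pw := psmooth_foldr s pu.
apply: taylor_partial.
- by move=> y; exact: smooth_diff pw.1.
- by move=> i y; exact: smooth_diff (psmooth_partial i pw).1.
- by move=> i j y; apply: (HK [:: j, i & s]).
Qed.

Definition opbnd N C (T : (E -> R) -> E -> R) :=
  forall u K, psmooth u -> bnd N K u -> forall x, `|T u x| <= C * K.

Record goodop (T : (E -> R) -> E -> R) : Prop := GoodOp {
  good_lin : forall a u v, psmooth u -> psmooth v ->
    T (fun y => a * u y + v y) = fun y => a * T u y + T v y ;
  good_saff : forall u b t, psmooth u ->
    T (fun y => u (saff b t y)) = fun y => T u (saff b t y) ;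
  good_bnd : exists N C, opbnd N C T }.

Section Good.
Local Open Scope classical_set_scope.
Local Open Scope ring_scope.
Variables (T : (E -> R) -> E -> R) (gT : goodop T).

Lemma good0 : T (fun=> 0) = fun=> 0.
Proof.
have := good_lin gT (-1) psmooth0 psmooth0.
rewrite (_ : (fun y => _) = fun=> 0); last by apply/funext => y; ring.
by move=> {1}->; apply/funext => y; ring.
Qed.

Lemma goodZ a u : psmooth u -> T (fun y => a * u y) = fun y => a * T u y.
Proof.
move=> pu; have := good_lin gT a pu psmooth0; rewrite good0.
rewrite (_ : (fun y => _) = fun y => a * u y); last by apply/funext => y; ring.
by move=> ->; apply/funext => y; ring.
Qed.

Lemma goodB u v : psmooth u -> psmooth v -> T (fun y => u y - v y) = fun y => T u y - T v y.
Proof.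
move=> pu pv; have := good_lin gT (-1) pv pu.
rewrite (_ : (fun y => _) = fun y => u y - v y); last by apply/funext => y; ring.
by move=> ->; apply/funext => y; ring.
Qed.

Lemma good_sum (I : Type) (r : seq I) (c : I -> R) (F : I -> E -> R) :
  (forall k, psmooth (F k)) ->
  T (fun y => \sum_(k <- r) c k * F k y) = fun y => \sum_(k <- r) c k * T (F k) y.
Proof.
move=> pF; elim: r => [|k r IH].
  rewrite (_ : (fun y => _) = fun=> 0); last by apply/funext => y; rewrite big_nil.
  by rewrite good0; apply/funext => y; rewrite big_nil.
rewrite (_ : (fun y => _) = fun y => c k * F k y + \sum_(l <- r) c l * F l y).
  rewrite good_lin//; last by apply: psmooth_sum => l; exact: psmoothZ.
  by apply/funext => y; rewrite IH big_cons.
by apply/funext => y; rewrite big_cons.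
Qed.

Lemma good_shift u h : psmooth u -> T (fun y => u (y + h)) = fun y => T u (y + h).
Proof.
move=> pu; have := good_saff gT (fun=> false) h pu.
by under [X in T X]eq_fun do rewrite saff_shift; move=> ->; apply/funext => y; rewrite saff_shift.
Qed.

(* Applying T to the Taylor remainder of u in the increment h gives the one of
   T u, by linearity and translation invariance; boundedness makes it O(|h|^2). *)
Lemma good_differentiable u x : psmooth u ->
  differentiable (T u) x /\ forall i, pd i (T u) x = T (pd i u) x.
Proof.
move=> pu; have [N [C HC]] := good_bnd gT; have [C' _ HC'] := bnd_remainder N pu.
apply: (@taylor_differentiable R _ (T u) (fun i => T (pd i u)) (C * C')) => h.
have := HC _ _ (psmooth_remainder h pu) (HC' h) x.
rewrite mulrA; apply: le_trans.
have -> : T (remainder u h) = fun y => T u (y + h) - T u y - \sum_(i < 8) h 0 i * T (pd i u) y.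
  rewrite goodB ?goodB ?good_shift//.
  - by rewrite good_sum// => i; exact: psmooth_partial.
  - exact: psmooth_shift.
  - by apply: psmoothB => //; exact: psmooth_shift.
  - by apply: psmooth_sum => i; apply: psmoothZ; exact: psmooth_partial.
by [].
Qed.

Lemma good_partial u i : psmooth u -> pd i (T u) = T (pd i u).
Proof. by move=> pu; apply/funext => x; have [_ ->] := good_differentiable x pu. Qed.

Lemma good_foldr u s : psmooth u -> foldr pd (T u) s = T (foldr pd u s).
Proof.
move=> pu; elim: s => //= i s ->.
by rewrite good_partial//; exact: psmooth_foldr.
Qed.

Lemma good_psmooth u : psmooth u -> psmooth (T u).
Proof.
move=> pu; split=> [s x|i x].
  by rewrite good_foldr//; have [] := good_differentiable x (psmooth_foldr s pu).
have := good_shift (2%:R *: delta_mx 0 i) pu.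
have -> : (fun y => u (y + 2%:R *: delta_mx 0 i)) = u by apply/funext => y; exact: pu.2.
by move=> /(congr1 (@^~ x)) /= <-.
Qed.

(** T commutes with derivatives, so it loses N of them at every order; this makes bounds compose. *)
Lemma good_bnd_foldr N M C u K : opbnd N C T -> psmooth u -> bnd (N + M) K u ->
  bnd M (C * K) (T u).
Proof.
move=> TC pu uK s sM x; rewrite good_foldr//.
apply: TC; first exact: psmooth_foldr.
by apply: bnd_foldr; apply: bndW uK; rewrite leq_add2l.
Qed.

End Good.

Lemma good_id : goodop id.
Proof. by split=> //; exists 0%N, 1 => u K _ b x; rewrite mul1r; exact: (b [::]). Qed.

Lemma good_comp T S : goodop T -> goodop S -> goodop (T \o S).
Proof.
move=> gT gS; split.
- by move=> a u v pu pv /=; rewrite (good_lin gS)// (good_lin gT)//; exact: good_psmooth.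
- by move=> u b t pu /=; rewrite (good_saff gS)// (good_saff gT)//; exact: good_psmooth.
have [N [C HC]] := good_bnd gT; have [M [D HD]] := good_bnd gS.
exists (M + N)%N, (C * D) => u K pu uK x; rewrite -mulrA.
apply: HC; first exact: good_psmooth.
exact: good_bnd_foldr HD pu uK.
Qed.

Lemma good_scale (c : R) : goodop (fun u y => c * u y).
Proof.
split=> //; first by move=> a u v _ _; apply/funext => y; ring.
exists 0%N, `|c| => u K _ b x; rewrite normrM ler_wpM2l//; exact: (b [::]).
Qed.

End GoodOp.

(** * Fourier expansion in one coordinate *)

Section Integral.
Local Open Scope classical_set_scope.
Local Open Scope ring_scope.
Context {R : realType}.
Implicit Types f g F : R -> R.

Definition int01 f : R := \int[@lebesgue_measure R]_(s in `[0, 1]) f s.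

Lemma continuous_integrable01 f : continuous f ->
  (@lebesgue_measure R).-integrable `[0, 1] (EFin \o f).
Proof.
move=> cf; apply: continuous_compact_integrable; first exact: segment_compact.
exact: continuous_subspaceT.
Qed.

Lemma int01_lin (a : R) f g : continuous f -> continuous g ->
  int01 (fun s => a * f s + g s) = a * int01 f + int01 g.
Proof.
move=> cf cg; rewrite /int01 RintegralD ?RintegralZl//;
  try exact: continuous_integrable01.
apply: continuous_integrable01 => s; apply: cvgM; first exact: cvg_cst.
exact: cf.
Qed.

Lemma int01_norm_le f (K : R) : continuous f ->
  (forall s, 0 <= s <= 1 -> `|f s| <= K) -> `|int01 f| <= K.
Proof.
move=> cf fK; apply: le_trans (le_normr_Rintegral _ _) _ => //.
  exact: continuous_integrable01.
apply: (@le_trans _ _ (int01 (fun=> K))).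
  apply: le_Rintegral => //.
  - apply: (@continuous_integrable01 (fun s => `|f s|)) => s.
    by apply: cvg_norm; exact: cf.
  - by apply: (@continuous_integrable01 (fun=> K)) => s; exact: cvg_cst.
have mu1 := @lebesgue_measure_itv R `[0, 1].
rewrite /int01 Rintegral_cst// [X in fine X](_ : _ = 1%E) ?mulr1//.
by apply: etrans mu1 _; rewrite /= lte01 oppr0 adde0.
Qed.

Lemma int01_FTC f F : continuous f -> (forall s : R, is_derive s 1 F (f s)) ->
  int01 f = F 1 - F 0.
Proof.
move=> cf dF.
have cF : continuous F.
  move=> s; apply: differentiable_continuous; apply/derivable1_diffP.
  exact: (ex_derive (is_derive := dF s)).
rewrite /int01 /Rintegral (@continuous_FTC2 _ f F)//.
- exact: continuous_subspaceT.
- split.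
  + by move=> s _; exact: (ex_derive (is_derive := dF s)).
  + by apply: cvg_at_right_filter; exact: cF.
  + by apply: cvg_at_left_filter; exact: cF.
- by move=> s _; rewrite derive1E (derive_val (is_derive := dF s)).
Qed.

(** With t = y / 2, the mean value theorem gives sin t >= t cos t, hence sin y = 2 sin t cos t >= 2
    t (cos t)^2 >= t. The last inequality is cos y >= 0 in the form (cos t)^2 >= 1/2. *)
Lemma half_le_sin (y : R) : 0 <= y <= pi / 2%:R -> y / 2%:R <= sin y.
Proof.
move=> /andP[y0 yp].
pose t := y / 2%:R; have t0 : 0 <= t by rewrite divr_ge0.
have pi0 := @pi_gt0 R.
have [|c cI] := @MVT_segment R sin cos 0 t t0 (fun s _ => is_derive_sin s).
  by apply: continuous_subspaceT => s; exact: continuous_sin.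
rewrite sin0 !subr0 => sE.
move: cI; rewrite in_itv/= => /andP[c0 ct].
have tE : y = t + t by rewrite /t; lra.
have ct' : cos t <= cos c.
  have [->//|ne] := eqVneq c t; apply/ltW.
  by rewrite ltr_cos ?in_itv/= ?lt_neqAle ?ne//; apply/andP; split; lra.
have c0' : 0 <= cos t by apply: cos_ge0_pihalf; apply/andP; split; lra.
have cy : 0 <= cos y by apply: cos_ge0_pihalf; apply/andP; split; lra.
rewrite -/t {1}tE sinD sE.
have : cos y = cos t ^+ 2 - sin t ^+ 2 by rewrite [in LHS]tE cosD !expr2.
rewrite sin2cos2 => cyE.
have H1 : t * cos t ^+ 2 <= cos c * t * cos t.
  by rewrite expr2 mulrA ler_wpM2r// [leRHS]mulrC ler_wpM2l.
have H2 : t * (1 / 2%:R) <= t * cos t ^+ 2 by rewrite ler_wpM2l//; lra.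
lra.
Qed.

(** A lower bound for the denominator 1 - cos (pi s) of the Fejer kernel: a numerator of order s^2
    is absorbed by it. *)
Lemma sqr_le_cos (s : R) : 0 <= s <= 1 -> s ^+ 2 <= 2%:R * (1 - cos (pi * s)).
Proof.
move=> /andP[s0 s1]; have pi2 := @pi_ge2 R.
pose y := pi * s / 2%:R.
have y0 : 0 <= y by rewrite divr_ge0// mulr_ge0//; lra.
have : y / 2%:R <= sin y.
  apply: half_le_sin; rewrite y0/= /y ler_pM2r// ler_piMr//; lra.
have -> : pi * s = y + y by rewrite /y; lra.
rewrite cosD -!expr2 cos2sin2 => H.
have sy : s / 2%:R <= sin y.
  apply: le_trans H; rewrite /y ler_pM2r// -[leLHS]mul1r mulrAC ler_wpM2r//; lra.
have : (s / 2%:R) ^+ 2 <= sin y ^+ 2 by rewrite ler_sqr ?nnegrE ?divr_ge0//; lra.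
rewrite expr_div_n; set z := sin y ^+ 2; lra.
Qed.

End Integral.

(** * Cosine modes and Fejer summation *)

Section Fourier.
Local Open Scope classical_set_scope.
Local Open Scope ring_scope.
Context {R : realType}.
Notation E := 'rV[R]_8.
Notation e_ i := (delta_mx 0 i : E).
Implicit Types (u v w : E -> R) (x h : E) (i j : 'I_8) (s : R) (kappa : R -> R).

Lemma is_derive_coord u x j (s : R) : smooth u ->
  is_derive s 1 (fun r : R => u (x + r *: e_ j)) (pd j u (x + s *: e_ j)).
Proof.
move=> su; have := is_derive_line (smooth_diff (x + s *: e_ j) su).
by rewrite -[in X in X -> _](scale1r (e_ j)) sum_delta mul1r scale1r.
Qed.

Lemma is_derive_coordN u x j (s : R) : smooth u ->
  is_derive s 1 (fun r : R => u (x - r *: e_ j)) (- pd j u (x - s *: e_ j)).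
Proof.
move=> su.
have du : differentiable u (x + s *: (- 1 *: e_ j)) by exact: smooth_diff.
have := is_derive_line du; rewrite sum_delta mulN1r.
rewrite scaleN1r scalerN; congr (is_derive _ _ _ _).
by apply/funext => r; rewrite scalerN.
Qed.

Lemma continuous_coord u x j : smooth u -> continuous (fun r : R => u (x + r *: e_ j)).
Proof.
move=> su s; apply: differentiable_continuous; apply/derivable1_diffP.
exact: (ex_derive (is_derive := is_derive_coord x j s su)).
Qed.

Lemma continuous_coordN u x j : smooth u -> continuous (fun r : R => u (x - r *: e_ j)).
Proof.
move=> su s; apply: differentiable_continuous; apply/derivable1_diffP.
exact: (ex_derive (is_derive := is_derive_coordN x j s su)).
Qed.

Definition sym u x j (s : R) := u (x + s *: e_ j) + u (x - s *: e_ j).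

Lemma continuous_sym u x j : smooth u -> continuous (sym u x j).
Proof.
by move=> su s; apply: cvgD; [exact: continuous_coord|exact: continuous_coordN].
Qed.

Lemma continuous_sym_mul u x j kappa : smooth u -> continuous kappa ->
  continuous (fun s => sym u x j s * kappa s).
Proof. by move=> su ck s; apply: cvgM; [exact: continuous_sym|exact: ck]. Qed.

(** Convolution along e_j over one period with the even extension of [kappa], folded onto [0, 1]. A
    reflection of x_j merely exchanges the two summands of [sym], which is why even kernels give
    operators commuting with [saff]. *)
Definition even_conv j kappa u x : R := int01 (fun s => sym u x j s * kappa s).

Lemma even_conv_opbnd j kappa (C : R) : continuous kappa ->
  (forall s, 0 <= s <= 1 -> `|kappa s| <= C) -> opbnd 0 (2%:R * C) (even_conv j kappa).
Proof.
move=> ck kC u K [su pu] uK x; apply: int01_norm_le; first exact: continuous_sym_mul.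
move=> s s01; rewrite normrM mulrAC ler_pM ?kC//.
rewrite mulr_natl mulr2n (le_trans (ler_normD _ _))// lerD//; exact: (uK [::]).
Qed.

Lemma good_even_conv j kappa (C : R) : continuous kappa ->
  (forall s, 0 <= s <= 1 -> `|kappa s| <= C) -> goodop (even_conv j kappa).
Proof.
move=> ck kC; split.
- move=> a u v [su _] [sv _]; apply/funext => x.
  rewrite /even_conv -int01_lin; [|exact: continuous_sym_mul|exact: continuous_sym_mul].
  by congr int01; apply/funext => s; rewrite /sym; ring.
- move=> u b t _; apply/funext => x; congr int01; apply/funext => s; rewrite /sym.
  rewrite -scaleNr !saffD mulNr scaleNr; congr (_ * _).
  by case: (b j); rewrite ?expr0 ?expr1 ?mulr1 ?mulrN1 ?scaleNr ?opprK// addrC.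
by exists 0%N, (2%:R * C); exact: even_conv_opbnd.
Qed.

Lemma even_conv_lin j (a : R) kappa1 kappa2 u x : smooth u -> continuous kappa1 -> continuous kappa2 ->
  even_conv j (fun s => a * kappa1 s + kappa2 s) u x = a * even_conv j kappa1 u x + even_conv j kappa2 u x.
Proof.
move=> su c1 c2; rewrite /even_conv -int01_lin; [|exact: continuous_sym_mul|exact: continuous_sym_mul].
by congr int01; apply/funext => s; ring.
Qed.

(** The period has length 2, on which the square of cos (n pi s) integrates to 1 for n > 0 and to 2
    for n = 0. The half makes [cos_mode j n] the projection onto frequency n in x_j in both
    cases. *)
Definition coef (n : nat) : R := if n == 0%N then 1 / 2%:R else 1.
Definition cosn (n : nat) (s : R) : R := cos (n%:R * pi * s).
Definition cos_kernel n s := coef n * cosn n s.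
Definition cos_mode j n := even_conv j (cos_kernel n).

Lemma is_derive_cosn n (s : R) : is_derive s 1 (cosn n) (- (n%:R * pi) * sin (n%:R * pi * s)).
Proof.
rewrite /cosn; apply: is_derive_eq; rewrite /GRing.scale/=; ring.
Qed.

Lemma is_derive_sinn n (s : R) : is_derive s 1 (fun s => sin (n%:R * pi * s)) ((n%:R * pi) * cosn n s).
Proof.
rewrite /cosn; apply: is_derive_eq; rewrite /GRing.scale/=; ring.
Qed.

Lemma continuous_cosn n : continuous (cosn n).
Proof.
move=> s; apply: differentiable_continuous; apply/derivable1_diffP.
exact: (ex_derive (is_derive := is_derive_cosn n s)).
Qed.

Lemma continuous_cos_kernel n : continuous (cos_kernel n).
Proof. by move=> s; apply: cvgM; [exact: cvg_cst|exact: continuous_cosn]. Qed.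

Lemma cos_kernel_le1 n s : `|cos_kernel n s| <= 1.
Proof.
rewrite normrM mulr_ile1 ?cos_max// /coef; case: ifP => _; rewrite ger0_norm//; lra.
Qed.

Lemma good_cos_mode j n : goodop (cos_mode j n).
Proof. by apply: (@good_even_conv _ _ 1); [exact: continuous_cos_kernel|move=> s _; exact: cos_kernel_le1]. Qed.

Lemma cos_mode_opbnd0 j n : opbnd 0 2%:R (cos_mode j n).
Proof.
rewrite -[2%:R]mulr1; apply: even_conv_opbnd; [exact: continuous_cos_kernel|move=> s _; exact: cos_kernel_le1].
Qed.

Lemma sin_natpi n : sin (n%:R * pi) = 0 :> R.
Proof.
elim: n => [|n IH]; first by rewrite mul0r sin0.
by rewrite -addn1 natrD mulrDl mul1r sinDpi IH oppr0.
Qed.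

Lemma cos_mode_eigen j n u : psmooth u ->
  cos_mode j n (pd j (pd j u)) = fun x => - (n%:R * pi) ^+ 2 * cos_mode j n u x.
Proof.
move=> pu; apply/funext => x.
have su := pu.1; have s1 := smooth_partial j su; have s2 := smooth_partial j s1.
apply/eqP; rewrite mulNr -addr_eq0 addrC /cos_mode /even_conv -int01_lin; last 2 first.
- by apply: continuous_sym_mul => //; exact: continuous_cos_kernel.
- by apply: continuous_sym_mul => //; exact: continuous_cos_kernel.
(* The boundary terms of two integrations by parts. They vanish at 0 by symmetry, and at 1 by
   periodicity and sin (n pi) = 0. *)
pose F (s : R) := coef n * ((pd j u (x + s *: e_ j) - pd j u (x - s *: e_ j)) * cosn n s
   + n%:R * pi * (u (x + s *: e_ j) + u (x - s *: e_ j)) * sin (n%:R * pi * s)).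
have dF s : is_derive s 1 F ((n%:R * pi) ^+ 2 * (sym u x j s * cos_kernel n s)
    + sym (pd j (pd j u)) x j s * cos_kernel n s).
  have d1 := is_derive_coord x j s su; have d2 := is_derive_coordN x j s su.
  have d3 := is_derive_coord x j s s1; have d4 := is_derive_coordN x j s s1.
  have d5 := is_derive_cosn n s; have d6 := is_derive_sinn n s.
  rewrite /F; apply: is_derive_eq.
  rewrite /sym /cos_kernel {F d1 d2 d3 d4 d5 d6}.
  move: (pd j u (x + s *: e_ j)) (pd j u (x - s *: e_ j)) => a1 a2.
  move: (pd j (pd j u) (x + s *: e_ j)) (pd j (pd j u) (x - s *: e_ j)) => b1 b2.
  move: (u (x + s *: e_ j)) (u (x - s *: e_ j)) => c1 c2.
  move: (cosn n s) (sin (n%:R * pi * s)) (coef n) (n%:R * pi) => C S k N.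
  rewrite /GRing.scale/=; ring.
rewrite (int01_FTC _ dF).
  have F0 : F 0 = 0 by rewrite /F !scale0r subr0 addr0 subrr mulr0 sin0 mul0r mulr0 addr0 mulr0.
  have F1 : F 1 = 0.
    rewrite /F mulr1 sin_natpi mulr0 addr0.
    have -> : x + 1 *: e_ j = x - 1 *: e_ j + 2%:R *: e_ j.
      by rewrite -addrA; congr (_ + _); rewrite -scaleNr -scalerDl; congr (_ *: _); ring.
    by rewrite (psmooth_partial j pu).2 subrr mul0r mulr0.
  by rewrite F0 F1 subrr.
move=> s; apply: cvgD; last by apply: continuous_sym_mul => //; exact: continuous_cos_kernel.
by apply: cvgM; [exact: cvg_cst|apply: continuous_sym_mul => //; exact: continuous_cos_kernel].
Qed.

(** Decays like 1/n^2 and telescopes, so its partial sums are explicit and at most 1. *)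
Definition weight (n : nat) : R := ((n.+1 * n.+2)%:R)^-1.

(** Decay in n is bought with two derivatives: by [cos_mode_eigen] the mode of u is that of its
    second derivative divided by -(n pi)^2. The constant 4 also covers n = 0, where [weight] is
    1/2. *)
Lemma cos_mode_opbnd j n : opbnd 2 (4%:R * weight n) (cos_mode j n).
Proof.
move=> u K pu uK x; have K0 := bnd_ge0 uK; have pi2 := @pi_ge2 R.
case: n => [|n].
  apply: le_trans (@cos_mode_opbnd0 j 0 u K pu (bndW (leq0n _) uK) x) _.
  by rewrite /weight ler_wpM2r//; lra.
have b2 : bnd 0 K (pd j (pd j u)) by apply/bnd_partial/bnd_partial.
have := @cos_mode_opbnd0 j n.+1 _ K (psmooth_partial j (psmooth_partial j pu)) b2 x.
have n0 : 0 < n.+1%:R :> R by rewrite ltr0n.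
set N : R := n.+1%:R in n0 *.
have Np : 0 < (N * pi) ^+ 2 by rewrite exprn_gt0// mulr_gt0// pi_gt0.
rewrite cos_mode_eigen// -/N mulNr normrN normrM (gtr0_norm Np).
rewrite -ler_pdivlMl// => /le_trans; apply.
rewrite mulrA ler_wpM2r// /weight ler_pdivlMr ?ltr0n// -mulrA ler_pdivrMl//.
rewrite natrM -[n.+3]addn2 -[n.+2]addn1 !natrD -/N.
have N1 : 1 <= N by rewrite /N ler1n.
have : N ^+ 2 * 4%:R <= (N * pi) ^+ 2 by rewrite exprMn ler_wpM2l ?sqr_ge0//; nra.
move: N1 => {b2 Np}; clear; move: ((N * pi) ^+ 2) => P; nra.
Qed.

Lemma sum_weight n : \sum_(0 <= k < n) weight k = 1 - n.+1%:R^-1.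
Proof.
elim: n => [|n IH]; first by rewrite big_geq// invr1 subrr.
rewrite big_nat_recr//= IH /weight natrM -[n.+2]addn1 natrD.
have : 0 < n.+1%:R :> R by rewrite ltr0n.
by move: n.+1%:R => N N0; field; apply/andP; split; lra.
Qed.

Lemma sum_weight_le1 n : \sum_(0 <= k < n) weight k <= 1.
Proof. by rewrite sum_weight gerBl invr_ge0. Qed.

Section Series.
Local Open Scope classical_set_scope.
Local Open Scope ring_scope.
Variables (t : nat -> R) (K : R).
Hypothesis tK : forall n, `|t n| <= K * weight n.

Lemma series_norm_le n : `|series t n| <= K.
Proof.
have K0 : 0 <= K.
  by have := le_trans (normr_ge0 _) (tK 0); rewrite pmulr_lge0// invr_gt0.
apply: le_trans (ler_norm_sum _ _ _) _.
apply: (@le_trans _ _ (\sum_(0 <= k < n) K * weight k)); first exact: ler_sum.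
by rewrite -mulr_sumr ler_piMr// sum_weight_le1.
Qed.

Lemma is_cvg_series_weight : cvgn (series t).
Proof.
apply: normed_cvg; apply: nondecreasing_is_cvgn.
  by apply: nondecreasing_series => n _ _; exact: normr_ge0.
have K0 : 0 <= K.
  by have := le_trans (normr_ge0 _) (tK 0); rewrite pmulr_lge0// invr_gt0.
exists K => _ [n _ <-] /=.
apply: (@le_trans _ _ (\sum_(0 <= k < n) K * weight k)); first exact: ler_sum.
by rewrite -mulr_sumr ler_piMr// sum_weight_le1.
Qed.

Lemma lim_series_norm_le : `|limn (series t)| <= K.
Proof.
rewrite ler_norml; apply/andP; split.
  apply: limr_ge; first exact: is_cvg_series_weight.
  by apply: nearW => n; have := series_norm_le n; rewrite ler_norml => /andP[].
apply: limr_le; first exact: is_cvg_series_weight.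
by apply: nearW => n; have := series_norm_le n; rewrite ler_norml => /andP[].
Qed.

End Series.

Definition serop (T : nat -> (E -> R) -> E -> R) u x : R := limn (series (fun n => T n u x)).

Section SerOp.
Local Open Scope classical_set_scope.
Local Open Scope ring_scope.
Variables (T : nat -> (E -> R) -> E -> R) (N : nat) (C : R).
Hypotheses (gT : forall n, goodop (T n)) (bT : forall n, opbnd N (C * weight n) (T n)).

Lemma serop_term_le u K x n : psmooth u -> bnd N K u -> `|T n u x| <= C * K * weight n.
Proof. by move=> pu uK; apply: le_trans (bT n pu uK x) _; rewrite mulrAC. Qed.

Lemma serop_cvg u x : psmooth u -> series (fun n => T n u x) @ \oo --> serop T u x.
Proof.
move=> pu; have [K HK] := bnd_exists N pu.
exact: (is_cvg_series_weight (fun n => serop_term_le x n pu HK)).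
Qed.

Lemma serop_opbnd : opbnd N C (serop T).
Proof.
move=> u K pu uK x; exact: (lim_series_norm_le (fun n => serop_term_le x n pu uK)).
Qed.

(** Linearity and commutation with [saff] pass to pointwise limits, and the bounds add up. Term by
    term differentiation is then a consequence of [good_partial] and needs no separate uniform
    convergence. *)
Lemma good_serop : goodop (serop T).
Proof.
split.
- move=> a u v pu pv; apply/funext => x.
  apply: cvg_lim => //.
  have -> : series (fun n => T n (fun y => a * u y + v y) x) =
     (fun n => a * series (fun n => T n u x) n + series (fun n => T n v x) n).
    apply/funext => n; rewrite /series/= mulr_sumr -big_split; apply: eq_bigr => k _.
    by rewrite (good_lin (gT k)).
  apply: cvgD; last exact: serop_cvg.
  by apply: cvgM; [exact: cvg_cst|exact: serop_cvg].
- move=> u b t pu; apply/funext => x; rewrite /serop.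
  suff -> : (fun n => T n (fun y => u (saff b t y)) x) = (fun n => T n u (saff b t x)) by [].
  by apply/funext => n; rewrite (good_saff (gT n)).
by exists N, C; exact: serop_opbnd.
Qed.
End SerOp.

Definition dirichlet (m : nat) s := \sum_(0 <= n < m.+1) cos_kernel n s.

(** The factor 1 - cos (pi s) turns a Dirichlet kernel into a difference of consecutive cosines,
    which telescopes when summed over m. *)
Lemma dirichlet_mul m s : dirichlet m s * (1 - cos (pi * s)) = (cosn m s - cosn m.+1 s) / 2%:R.
Proof.
rewrite /dirichlet; elim: m => [|m IH].
  rewrite big_nat1 /cos_kernel /coef /cosn /= !mul0r cos0 !mul1r mulr1; lra.
rewrite big_nat_recr//= mulrDl IH /cos_kernel /coef/= mul1r /cosn.
have nS n : (n.+1%:R : R) = n%:R + 1 by rewrite -addn1 natrD.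
have -> : m.+2%:R * pi * s = m.+1%:R * pi * s + pi * s by rewrite (nS m.+1); ring.
have -> : m%:R * pi * s = m.+1%:R * pi * s - pi * s by rewrite (nS m); ring.
move: (m.+1%:R * pi * s) (pi * s) => A B; rewrite cosB cosD.
by move: (cos A) (cos B) (sin A) (sin B) => *; field.
Qed.

Lemma sum_dirichlet_mul N s : (\sum_(0 <= m < N) dirichlet m s) * (1 - cos (pi * s)) = (1 - cosn N s) / 2%:R.
Proof.
elim: N => [|N IH]; first by rewrite big_geq// /cosn !mul0r cos0 subrr mul0r.
by rewrite big_nat_recr//= mulrDl IH dirichlet_mul; field.
Qed.

Lemma continuous_sum_nat (F : nat -> R -> R) N : (forall n, continuous (F n)) ->
  continuous (fun s => \sum_(0 <= n < N) F n s).
Proof.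
move=> cF; elim: N => [|N IH].
  rewrite (_ : (fun s => _) = cst 0); first by move=> s; exact: cvg_cst.
  by apply/funext => s; rewrite big_geq.
rewrite (_ : (fun s => _) = fun s => \sum_(0 <= n < N) F n s + F N s).
  by move=> s; apply: cvgD; [exact: IH|exact: cF].
by apply/funext => s; rewrite big_nat_recr.
Qed.

Lemma continuous_dirichlet m : continuous (dirichlet m).
Proof. by apply: continuous_sum_nat => n; exact: continuous_cos_kernel. Qed.

Lemma series_cos_mode j u x m : smooth u ->
  series (fun n => cos_mode j n u x) m.+1 = even_conv j (dirichlet m) u x.
Proof.
move=> su; rewrite /dirichlet /series/=; elim: m => [|m IH].
  rewrite !big_nat1 /cos_mode; congr (even_conv j _ u x).
  by apply/funext => s; rewrite big_nat1.
rewrite big_nat_recr//= IH addrC -[cos_mode j m.+1 u x]mul1r -even_conv_lin//.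
- by congr (even_conv j _ u x); apply/funext => s; rewrite [in RHS]big_nat_recr//= mul1r addrC.
- exact: continuous_cos_kernel.
- exact: continuous_dirichlet.
Qed.

Lemma sum_even_conv_dirichlet j u x N : smooth u ->
  \sum_(0 <= m < N) even_conv j (dirichlet m) u x = even_conv j (fun s => \sum_(0 <= m < N) dirichlet m s) u x.
Proof.
move=> su; elim: N => [|N IH].
  rewrite big_geq//; have := even_conv_lin j (-1) x su (@continuous_cos_kernel 0) (@continuous_cos_kernel 0).
  rewrite mulN1r addNr => k0; apply: etrans (esym k0) _; congr (even_conv j _ u x).
  by apply/funext => s; rewrite big_geq// mulN1r addNr.
rewrite big_nat_recr//= IH addrC -[even_conv j (dirichlet N) u x]mul1r -even_conv_lin//.
- by congr (even_conv j _ u x); apply/funext => s; rewrite [in RHS]big_nat_recr//= mul1r addrC.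
- exact: continuous_dirichlet.
- by apply: continuous_sum_nat => m; exact: continuous_dirichlet.
Qed.

(* Fejer summation: the Cesaro means of the Dirichlet kernel, multiplied by
   1 - cos (pi s), telescope to a bounded function. *)
Lemma sum_cos_mode_vanish j w x : psmooth w -> w x = 0 -> serop (cos_mode j) w x = 0.
Proof.
move=> pw wx; have sw := pw.1.
have Qc : series (fun n => cos_mode j n w x) @ \oo --> serop (cos_mode j) w x.
  exact: (serop_cvg (N := 2) (C := 4%:R) (fun n => @cos_mode_opbnd j n)).
have [C C0 HC] := bnd_remainder 0 pw.
(* As w x = 0 and the linear terms at s and -s cancel, [sym] is of order s^2. *)
have symC s : 0 <= s <= 1 -> `|sym w x j s| <= 2%:R * C * s ^+ 2.
  move=> /andP[s0 s1].
  have -> : sym w x j s = remainder w (s *: e_ j) x + remainder w (- s *: e_ j) x.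
    rewrite /remainder !sum_delta wx /sym -scaleNr mulNr; ring.
  rewrite (le_trans (ler_normD _ _))// mulrDl mul1r mulrDl.
  have CC e : `|e| = s -> `|remainder w (e *: e_ j) x| <= C * s ^+ 2.
    move=> es; apply: le_trans (HC (e *: e_ j) [::] isT x) _.
    rewrite ler_wpM2l// normrZ es exprMn ler_piMr ?sqr_ge0//.
    by rewrite expr_le1 ?norm_delta_le1.
  by rewrite lerD ?CC ?normrN ?ger0_norm.
have bd N : `|\sum_(0 <= m < N) series (fun n => cos_mode j n w x) m.+1| <= 4%:R * C.
  rewrite (eq_bigr (fun m => even_conv j (dirichlet m) w x)); last by move=> m _; exact: series_cos_mode.
  rewrite sum_even_conv_dirichlet//; apply: int01_norm_le.
    by apply: continuous_sym_mul => //; apply: continuous_sum_nat => m; exact: continuous_dirichlet.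
  move=> s s01; rewrite normrM.
  apply: (@le_trans _ _ (4%:R * C * ((1 - cos (pi * s)) * `|\sum_(0 <= m < N) dirichlet m s|))).
    rewrite mulrA ler_wpM2r// (le_trans (symC s s01))//.
    have -> : 4%:R * C = 2%:R * C * 2%:R by ring.
    by rewrite -[leRHS]mulrA ler_wpM2l ?mulr_ge0// sqr_le_cos.
  have c1 : 0 <= 1 - cos (pi * s) by rewrite subr_ge0 cos_le1.
  have -> : (1 - cos (pi * s)) * `|\sum_(0 <= m < N) dirichlet m s| = `|(1 - cosn N s) / 2%:R|.
    by rewrite -sum_dirichlet_mul normrM (ger0_norm c1) mulrC.
  rewrite ler_piMr ?mulr_ge0//.
  have := cos_le1 (N%:R * pi * s); have := cos_geN1 (N%:R * pi * s).
  rewrite /cosn => h1 h2; rewrite ler_norml; apply/andP; split; lra.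
(* The Cesaro means converge to the sum of the series, while the bound uniform in N sends them to 0.
   The shift by one skips the empty partial sum. *)
have ces := cesaro (cvg_comp _ _ (cvg_addnr 1) Qc).
apply: (cvg_unique _ ces) => //; apply/norm_cvg0P.
apply: (@squeeze_cvgr _ _ _ _ (fun=> 0) (fun n => 4%:R * C * harmonic n)).
- apply: nearW => n; rewrite normr_ge0/= /arithmetic_mean normrM ger0_norm ?invr_ge0//.
  rewrite mulrC ler_wpM2r ?invr_ge0//.
  apply: le_trans (bd n.+1); rewrite /series /=.
  by under eq_bigr do rewrite addn1.
- exact: cvg_cst.
- rewrite -[X in _ --> X](mulr0 (4%:R * C)); apply: cvgM; first exact: cvg_cst.
  exact: cvg_harmonic.
Qed.

Lemma cos_mode_cst j n (c : R) x : cos_mode j n (fun=> c) x = if n == 0%N then c else 0.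
Proof.
have pc := @psmooth_cst R (c).
case: eqP => [->|/eqP n0].
  rewrite /cos_mode /even_conv (_ : (fun s => _) = fun=> c); last first.
    by apply/funext => s; rewrite /sym /cos_kernel /coef /cosn/= !mul0r cos0; lra.
  have dF s : is_derive s 1 (fun s => c * s) c.
    by apply: is_derive_eq; rewrite /GRing.scale/= mulr1.
  rewrite (int01_FTC _ dF) ?mulr0 ?mulr1 ?subr0//; by move=> s; exact: cvg_cst.
have := cos_mode_eigen j n pc; have p0 i : pd i (fun=> c) = fun=> 0.
  by apply/funext => y; rewrite /pd /partial derive_cst.
rewrite !p0.
rewrite (_ : pd j _ = fun=> 0); last by apply/funext => y; rewrite /pd /partial derive_cst.
rewrite (good0 (good_cos_mode j n)) => /(congr1 (@^~ x))/esym/eqP.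
rewrite mulf_eq0 oppr_eq0 expf_eq0/= mulf_eq0 pnatr_eq0 (negbTE n0) gt_eqF ?pi_gt0//=.
by move=> /eqP.
Qed.

(** Subtracting the constant u x reduces to a function vanishing at x; a constant has only its mode
    n = 0. *)
Lemma sum_cos_mode j u x : psmooth u -> serop (cos_mode j) u x = u x.
Proof.
move=> pu.
have pc := @psmooth_cst R (u x).
have gs : goodop (serop (cos_mode j)).
  exact: (good_serop (N := 2) (C := 4%:R) (good_cos_mode j) (fun n => @cos_mode_opbnd j n)).
have := @sum_cos_mode_vanish j (fun y => u y - u x) x (psmoothB pu pc) (subrr _).
rewrite (goodB gs pu pc) => /eqP; rewrite subr_eq0 => /eqP ->.
apply: cvg_lim => //.
have -> : series (fun n => cos_mode j n (fun=> u x) x) = fun n => if n is 0%N then 0 else u x.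
  apply/funext => -[|n]; first by rewrite /series/= big_geq.
  rewrite /series/= big_nat_recl//= cos_mode_cst eqxx big1 ?addr0// => k _.
  by rewrite cos_mode_cst.
rewrite -(cvg_shiftS _); exact: cvg_cst.
Qed.

End Fourier.

(** * The Green operator of the torus *)

Section Green.
Local Open Scope classical_set_scope.
Local Open Scope ring_scope.
Context {R : realType}.
Notation E := 'rV[R]_8.
Implicit Types (u v w : E -> R) (x h : E) (i j : 'I_8) (l : seq 'I_8).

(* Inverse of sum_(j <- l) d_j^2 - pi^2 k, one Fourier expansion per
   coordinate; for k = 0 the constant mode is sent to 0 since 0^-1 = 0. *)
Fixpoint green l (k : nat) : (E -> R) -> E -> R :=
  if l is j :: l' then serop (fun n => green l' (k + n ^ 2) \o cos_mode j n)
  else fun u x => - (pi ^+ 2 * k%:R)^-1 * u x.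

(** The average over the coordinates in [l]: the part of a function that cannot be recovered from
    its Laplacian. *)
Fixpoint mean l : (E -> R) -> E -> R :=
  if l is j :: l' then mean l' \o cos_mode j 0 else id.

Lemma green_term_opbnd T N (C : R) j n : opbnd N C T ->
  opbnd (2 + N) (C * 4%:R * weight n) (T \o cos_mode j n).
Proof.
move=> bT u K pu uK x; rewrite /= -!mulrA.
apply: bT; first exact: good_psmooth (good_cos_mode j n) _ pu.
have := good_bnd_foldr (good_cos_mode j n) (@cos_mode_opbnd R j n) pu uK.
by rewrite -mulrA.
Qed.

(** N and C are chosen before k: the series for one more coordinate involves all operators
    [green l (k + n ^ 2)] at once and needs a common bound for them. *)
Lemma green_good_opbnd l : exists N C, forall k, goodop (green l k) /\ opbnd N C (green l k).
Proof.
elim: l => [|j l [N [C IH]]].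
  exists 0%N, 1 => k; split; first exact: good_scale.
  move=> u K _ uK x; rewrite /= normrM; apply: ler_pM => //; last exact: (uK [::]).
  have pi2 := @pi_ge2 R; rewrite normrN; case: k => [|k].
    by rewrite mulr0 invr0 normr0.
  have k1 : 1 <= k.+1%:R :> R by rewrite ler1n.
  have p1 : 1 <= pi ^+ 2 * k.+1%:R :> R.
    by rewrite mulr_ege1// expr_ge1// (le_trans _ pi2)// ler1n.
  by rewrite ger0_norm ?invr_ge0 ?(le_trans ler01)// invf_le1// (lt_le_trans ltr01).
exists (2 + N)%N, (C * 4%:R) => k; split.
  apply: (@good_serop _ _ (2 + N)%N (C * 4%:R)) => n.
    exact: good_comp (IH _).1 (good_cos_mode j n).
  exact: green_term_opbnd (IH _).2.
by apply: serop_opbnd => n; exact: green_term_opbnd (IH _).2.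
Qed.

Lemma good_green l k : goodop (green l k).
Proof. by have [N [C /(_ k)[]]] := green_good_opbnd l. Qed.

Lemma good_mean l : goodop (mean l).
Proof. by elim: l => [|j l IH]; [exact: good_id|exact: good_comp IH (good_cos_mode j 0)]. Qed.

Definition lap l u x := \sum_(j <- l) pd j (pd j u) x.

Lemma psmooth_lap l u : psmooth u -> psmooth (lap l u).
Proof. by move=> pu; apply: psmooth_sum => j; do 2 apply: psmooth_partial. Qed.

Lemma good_lap T l u : goodop T -> psmooth u -> T (lap l u) = lap l (T u).
Proof.
move=> gT pu; have := good_sum gT l (fun=> 1) (F := fun j => pd j (pd j u)).
have -> : (fun y => \sum_(k <- l) 1 * pd k (pd k u) y) = lap l u.
  by apply/funext => y; apply: eq_bigr => j _; rewrite mul1r.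
have pF j : psmooth (pd j (pd j u)) by do 2 apply: psmooth_partial.
move=> /(_ pF) ->; apply/funext => y; apply: eq_bigr => j _; rewrite mul1r.
by rewrite !(good_partial gT)//; exact: psmooth_partial.
Qed.

(** On the n-th mode in x_j the operator d_j^2 is -(n pi)^2, so the induction hypothesis applies
    with k + n^2. Summing over n gives u back by [sum_cos_mode]; a mean is lost only where k + n^2 =
    0. *)
Lemma green_lapB l k u x : psmooth u ->
  green l k (fun y => lap l u y - pi ^+ 2 * k%:R * u y) x
  = u x - (if k == 0%N then mean l u x else 0).
Proof.
elim: l k u x => [|j l IH] k u x pu.
  rewrite /= /lap big_nil sub0r; case: k => [|k].
    by rewrite mulr0 invr0 oppr0 !mul0r eqxx subrr.
  have k0 : pi ^+ 2 * k.+1%:R != 0 :> R.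
    by rewrite mulf_neq0 ?pnatr_eq0// expf_neq0// gt_eqF// pi_gt0.
  by rewrite mulrNN mulrA mulVf// mul1r subr0.
rewrite /=; apply: cvg_lim => //.
have pl := psmooth_lap l pu.
have tE n : (green l (k + n ^ 2) \o cos_mode j n) (fun y => lap (j :: l) u y - pi ^+ 2 * k%:R * u y) x
   = cos_mode j n u x - (if n == 0%N then if k == 0%N then mean l (cos_mode j 0 u) x else 0 else 0).
  have gQ := good_cos_mode (R := R) j n; have pQ := good_psmooth gQ pu.
  have pj : psmooth (pd j (pd j u)) by do 2 apply: psmooth_partial.
  rewrite /=.
  have -> : (fun y => lap (j :: l) u y - pi ^+ 2 * k%:R * u y) =
     fun y => 1 * pd j (pd j u) y + (- (pi ^+ 2 * k%:R) * u y + lap l u y).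
    by apply/funext => y; rewrite /lap big_cons mul1r mulNr addrAC addrA.
  have pm := psmooth_lin (- (pi ^+ 2 * k%:R)) pu pl.
  rewrite (good_lin gQ 1 pj pm) (good_lin gQ _ pu pl) (cos_mode_eigen j n pu) (good_lap l gQ pu).
  have -> : (fun y => 1 * (- (n%:R * pi) ^+ 2 * cos_mode j n u y) +
      (- (pi ^+ 2 * k%:R) * cos_mode j n u y + lap l (cos_mode j n u) y)) =
    fun y => lap l (cos_mode j n u) y - pi ^+ 2 * (k + n ^ 2)%:R * cos_mode j n u y.
    apply/funext => y; rewrite natrD natrX.
    by move: (lap _ _ _) (cos_mode _ _ _ _) => a b; ring.
  rewrite IH//; congr (_ - _); rewrite addn_eq0 expn_eq0 andbT.
  by case: k n {gQ pQ pm} => [|k] [|n].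
under eq_fun do rewrite tE.
set b := (if k == 0%N then _ else _).
have -> : series (fun n => cos_mode j n u x - (if n == 0%N then b else 0)) =
   fun n => series (fun n => cos_mode j n u x) n - (if n is 0%N then 0 else b).
  apply/funext => -[|n]; first by rewrite /series/= !big_geq// subr0.
  by rewrite /series/= sumrB; congr (_ - _); rewrite big_nat_recl//= big1 ?addr0.
apply: cvgB; last by rewrite -(cvg_shiftS _); exact: cvg_cst.
rewrite -[X in _ --> X](sum_cos_mode j x pu).
exact: (serop_cvg (N := 2) (C := 4%:R) (fun n => @cos_mode_opbnd R j n)).
Qed.

Lemma cos_mode0_pd j u : psmooth u -> cos_mode j 0 (pd j u) = fun=> 0.
Proof.
move=> pu; apply/funext => x; rewrite /cos_mode /even_conv.
have dF (s : R) : is_derive s 1 (fun s : R => 1 / 2%:R * (u (x + s *: delta_mx 0 j) - u (x - s *: delta_mx 0 j)))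
   (sym (pd j u) x j s * cos_kernel 0 s).
  have d1 := is_derive_coord x j s pu.1; have d2 := is_derive_coordN x j s pu.1.
  apply: is_derive_eq; rewrite /sym /cos_kernel /coef /cosn /= !mul0r cos0 /GRing.scale/=.
  by move: (pd j u _) (pd j u _) => a b; ring.
rewrite (int01_FTC _ dF).
  have -> : x + 1 *: delta_mx 0 j = x - 1 *: delta_mx 0 j + 2%:R *: delta_mx 0 j.
    by rewrite -addrA; congr (_ + _); rewrite -scaleNr -scalerDl; congr (_ *: _); ring.
  by rewrite pu.2 !scale0r subr0 addr0 !subrr.
by apply: continuous_sym_mul; [exact: (psmooth_partial j pu).1|exact: continuous_cos_kernel].
Qed.

Lemma mean_pd l j u : psmooth u -> j \in l -> mean l (pd j u) = fun=> 0.
Proof.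
elim: l u => //= i l IH u pu; rewrite inE => /predU1P[->|jl].
  by rewrite cos_mode0_pd// (good0 (good_mean l)).
rewrite -(good_partial (good_cos_mode i 0))// IH//.
exact: good_psmooth (good_cos_mode i 0) _ pu.
Qed.

Definition Lap u x := \sum_(j < 8) pd j (pd j u) x.
Definition green_op := green (index_enum 'I_8) 0.
Definition mean_op := mean (index_enum 'I_8).

Lemma good_green_op : goodop green_op. Proof. exact: good_green. Qed.
Lemma good_mean_op : goodop mean_op. Proof. exact: good_mean. Qed.

Lemma green_op_Lap u x : psmooth u -> green_op (Lap u) x = u x - mean_op u x.
Proof.
move=> pu; rewrite -[RHS](green_lapB (index_enum 'I_8) 0 x pu); congr (green _ _ _ x).
by apply/funext => y; rewrite mulr0 mul0r subr0.
Qed.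

(** All partial derivatives of the mean vanish, since it commutes with them and kills
    derivatives. *)
Lemma mean_op_cst u x h : psmooth u -> mean_op u (x + h) = mean_op u x.
Proof.
move=> pu; have pM := good_psmooth good_mean_op pu.
have [c _] := MVT_line x h (fun y => smooth_diff y pM.1).
rewrite big1 => [/eqP|i _]; first by rewrite subr_eq0 => /eqP.
by rewrite (good_partial good_mean_op)// /mean_op mean_pd ?mem_index_enum// mulr0.
Qed.

End Green.

(** * Exterior derivative and pullback *)

Section Calculus.
Context {R : realType}.
Notation E := 'rV[R]_8.

Lemma partial_cst (V : normedModType R) (i : 'I_8) (c : V) (x : E) : partial i (fun=> c) x = 0.
Proof. by rewrite /partial derive_cst. Qed.

Lemma extdE (V : normedModType R) (a : E -> Defs.form V) x K : extd a x K =
  \sum_(i in K) wedge_sign [set i] (K :\ i) *: partial i (fun y => a y (K :\ i)) x.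
Proof.
rewrite /extd sum_ffunE [RHS]big_mkcond; apply: eq_bigr => i _.
rewrite -[dx1 i]scale1r wedge_dx1; case: ifP => // _.
by rewrite ffunE mul1r.
Qed.

Lemma extd_degree (V : normedModType R) (a : E -> Defs.form V) k x :
  (forall y, of_degree k (a y)) -> of_degree k.+1 (extd a x).
Proof.
move=> ak K Kk; rewrite extdE big1// => i iK.
rewrite (_ : (fun y => _) = fun=> 0) ?partial_cst ?scaler0//.
apply/funext => y; apply: ak; apply: contra Kk => /eqP <-.
by rewrite (cardsD1 i K) iK.
Qed.

Lemma extd_set1 (V : normedModType R) (a : E -> Defs.form V) x i :
  extd a x [set i] = partial i (fun y => a y finset.set0) x.
Proof.
rewrite extdE big_set1 finset.setDv wedge_sign_lt ?scale1r// => j.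
by rewrite inE.
Qed.

Lemma set_of_seq2 (i j : nat) : (i < 8)%N -> (j < 8)%N ->
  set_of_seq [:: i; j] = [set inord i; inord j].
Proof.
by move=> i8 j8; apply/finset.setP => l; rewrite !inE -!val_eqE /= !inordK.
Qed.

Lemma extd_pair (V : normedModType R) (a : E -> Defs.form V) x (i j : nat) : (i < j < 8)%N ->
  extd a x (set_of_seq [:: i; j]) = partial (inord i) (fun y => a y [set inord j]) x
   - partial (inord j) (fun y => a y [set inord i]) x.
Proof.
move=> /andP[ij j8]; have i8 := ltn_trans ij j8.
have vi : (inord i : 'I_8) = i :> nat by rewrite inordK.
have vj : (inord j : 'I_8) = j :> nat by rewrite inordK.
have ne : (inord i : 'I_8) != inord j by rewrite -val_eqE /= vi vj ltn_eqF.
rewrite set_of_seq2// extdE big_setU1 ?inE// big_set1.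
have -> : [set inord i; inord j] :\ inord i = [set inord j] :> {set 'I_8}.
  by rewrite finset.setU1K// inE.
have -> : [set inord i; inord j] :\ inord j = [set inord i] :> {set 'I_8}.
  by rewrite finset.setUC finset.setU1K// inE eq_sym.
rewrite (@wedge_sign_gt _ (inord j) (inord i)) ?vi ?vj// scaleN1r wedge_sign_lt ?scale1r// => l.
by rewrite inE => /eqP ->; rewrite vi vj.
Qed.

Lemma jacobian_saff (b : 'I_8 -> bool) (t x : E) j i :
  ('J (saff b t) x) j i = (-1) ^+ b i * (j == i)%:R.
Proof.
have := deriveEjacobian (delta_mx 0 j) (saff_differentiable b t x).
rewrite -rowE -[LHS]/(partial j (saff b t) x) (saff_taylor b t x).2 => /rowP/(_ i).
rewrite !mxE eqxx /= => <-; rewrite eq_sym; case: eqP => [->//|_].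
by rewrite !mulr0.
Qed.

Definition form_sign (b : 'I_8 -> bool) (I : {set 'I_8}) : R := \prod_(i in I) (-1) ^+ b i.

(** The linear part is diagonal, so each dx_I is only multiplied by a sign and equivariance can be
    stated one component at a time. *)
Lemma pullback_saff (V : normedModType R) (b : 'I_8 -> bool) (t x : E) (a : E -> Defs.form V) K :
  pullback (saff b t) a x K = form_sign b K *: a (saff b t x) K.
Proof.
rewrite /pullback sum_ffunE (bigD1 K)//= big1 ?addr0 => [|I IK].
all: rewrite ffunE.
all: under eq_bigr => i _ do
  (rewrite (_ : \sum_(j < 8) _ = (-1) ^+ b i *: dx1 i); last
    (rewrite (bigD1 i)//= big1 ?addr0 => [|j ji];
    [by rewrite jacobian_saff eqxx mulr1 | by rewrite jacobian_saff (negbTE ji) mulr0 scale0r])).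
all: rewrite (wedge_sorted (fun i => (-1) ^+ b i) (sorted_enum_set _)) ffunE.
  by rewrite set_enum eqxx mulr1 big_enum.
by rewrite set_enum eq_sym (negbTE IK) mulr0 scale0r.
Qed.

Lemma saff_id : saff (fun=> false) 0 = id :> (E -> E).
Proof. by apply/funext => x; rewrite saff_shift addr0. Qed.

Lemma orb_tauE i : orb_tau i = saff (fun=> false) (delta_mx 0 i) :> (E -> E).
Proof. by apply/funext => x; rewrite saff_shift. Qed.

Lemma saff_comp b t b' t' : saff b t \o saff b' t' =
  saff (fun i => b i (+) b' i) (saff b t t') :> (E -> E).
Proof.
apply/funext => x; apply/rowP => i; rewrite !mxE signr_addb; ring.
Qed.

Lemma pi1orb_saff (g : E -> E) : pi1orb g -> exists b t, g = saff b t.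
Proof.
elim=> {g}.
- exists (fun i => i < 4)%N, 0; apply/funext => x; apply/rowP => -[[|[|[|[|[|[|[|[|//]]]]]]]] i8];
    by rewrite !mxE /= ?expr1 ?expr0.
- exists (fun i => 3 < i)%N, 0; apply/funext => x; apply/rowP => -[[|[|[|[|[|[|[|[|//]]]]]]]] i8];
    by rewrite !mxE /= ?expr1 ?expr0.
- exists (fun i => val i \in [:: 0; 1; 4; 5]%N), (\row_i [:: 2^-1; 2^-1; 0; 0; 2^-1; 2^-1; 0; 0]`_i).
  apply/funext => x; apply/rowP => -[[|[|[|[|[|[|[|[|//]]]]]]]] i8]; by rewrite !mxE /= ?expr1 ?expr0.
- exists (fun i => val i \in [:: 0; 2; 4; 6]%N), (\row_i [:: 0; 0; 2^-1; 0; 2^-1; 0; 2^-1; 0]`_i).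
  apply/funext => x; apply/rowP => -[[|[|[|[|[|[|[|[|//]]]]]]]] i8]; by rewrite !mxE /= ?expr1 ?expr0.
- by move=> i; exists (fun=> false), (delta_mx 0 i); exact: orb_tauE.
- by exists (fun=> false), 0; rewrite saff_id.
- move=> g h _ [b [t ->]] _ [b' [t' ->]].
  by exists (fun i => b i (+) b' i), (saff b t t'); exact: saff_comp.
move=> g h _ [b [t ->]] gh hg; exists b, (saff b 0 (- t)).
apply/funext => x; rewrite -[in RHS](hg x); apply/rowP => i; rewrite !mxE.
by case: (b i); rewrite ?expr1 ?expr0; ring.
Qed.

End Calculus.

(** * Equivariant matrix-valued functions *)

Section MatrixFunctions.
Local Open Scope classical_set_scope.
Local Open Scope ring_scope.
Context {R : realType} {m n : nat}.
Notation E := 'rV[R]_8.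
Notation M := 'M[R]_(m.+1, n.+1).
Implicit Types (F : E -> M) (x : E) (i : 'I_8).

Definition entry (p : 'I_m.+1) (q : 'I_n.+1) F : E -> R := fun x => F x p q.

Lemma entry_differentiable F x p q : differentiable F x -> differentiable (entry p q F) x.
Proof.
move=> dF; apply: (@differentiable_comp _ _ _ _ F (fun A : M => A p q)) => //.
exact: differentiable_coord.
Qed.

Lemma pd_entry F x p q i : differentiable F x -> pd i (entry p q F) x = partial i F x p q.
Proof.
move=> dF; have := diff_derivable (v := delta_mx 0 i) dF; rewrite /derivable => cF.
have /= := @cvg_comp _ _ _ _ (fun A : M => A p q) _ _ _ cF (@coord_continuous _ _ _ p q _).
move=> cF'; rewrite /pd [LHS]/partial /derive; apply: cvg_lim => //.
apply: cvg_trans cF'; apply: near_eq_cvg; apply: nearW => h /=.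
by rewrite /entry !mxE.
Qed.

Lemma differentiable_entry F x : (forall p q, differentiable (entry p q F) x) -> differentiable F x.
Proof.
move=> dF.
rewrite (_ : F = \sum_(p < m.+1) \sum_(q < n.+1) (fun y => entry p q F y *: (delta_mx p q : M))).
  apply: differentiable_sum => p; apply: differentiable_sum => q.
  exact: differentiableZl.
apply/funext => y; rewrite fct_sumE [LHS]matrix_sum_delta; apply: eq_bigr => p _.
by rewrite fct_sumE.
Qed.

Lemma foldr_partial_entry F s x p q : smooth F -> foldr pd (entry p q F) s x = foldr partial F s x p q.
Proof.
move=> sF; elim: s x => //= i s IH x.
rewrite -(pd_entry _ _ _ (sF s x)); congr (pd i _ x); apply/funext => y; exact: IH.
Qed.

Lemma smooth_entry F p q : smooth F -> smooth (entry p q F).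
Proof.
move=> sF s x; have := entry_differentiable p q (sF s x).
by congr (differentiable _ _); apply/funext => y; rewrite /entry -foldr_partial_entry.
Qed.

Lemma entry_smooth F : (forall p q, smooth (entry p q F)) -> smooth F.
Proof.
move=> sF.
(* The entrywise formula at one order needs differentiability at the preceding order, so the two are
   proved together. *)
suff H s : foldr partial F s = (fun y => \matrix_(p, q) foldr pd (entry p q F) s y)
    /\ forall x, differentiable (foldr partial F s) x.
  by move=> s x; have [_] := H s; exact.
elim: s => [|i s [IH dI]].
  split; first by apply/funext => y; apply/matrixP => p q; rewrite mxE.
  by move=> x; apply: differentiable_entry => p q; exact: (sF p q [::] x).
have E1 : foldr partial F (i :: s) = (fun y => \matrix_(p, q) foldr pd (entry p q F) (i :: s) y).
  apply/funext => y; apply/matrixP => p q; rewrite mxE /= -(pd_entry p q i (dI y)).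
  by congr (pd i _ y); apply/funext => z; rewrite /entry IH mxE.
split=> // x; rewrite E1; apply: differentiable_entry => p q.
have := sF p q (i :: s) x.
by congr (differentiable _ _); apply/funext => y; rewrite /entry mxE.
Qed.

Lemma entry_partial F i p q : smooth F -> entry p q (partial i F) = pd i (entry p q F).
Proof. by move=> sF; apply/funext => x; rewrite pd_entry//; exact: (sF [::]). Qed.

Definition mx_op (T : (E -> R) -> E -> R) F x : M := \matrix_(p, q) T (entry p q F) x.

Lemma entry_mx_op T F p q : entry p q (mx_op T F) = T (entry p q F).
Proof. by apply/funext => x; rewrite /entry mxE. Qed.

Definition msmooth F := forall p q, psmooth (entry p q F).

Lemma msmooth_smooth F : msmooth F -> smooth F.
Proof. by move=> pF; apply: entry_smooth => p q; have [] := pF p q. Qed.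

Lemma msmooth_partial F i : msmooth F -> msmooth (partial i F).
Proof.
by move=> pF p q; rewrite entry_partial; [exact: psmooth_partial|exact: msmooth_smooth].
Qed.

Lemma msmooth_mx_op T F : goodop T -> msmooth F -> msmooth (mx_op T F).
Proof. by move=> gT pF p q; rewrite entry_mx_op; exact: good_psmooth. Qed.

Lemma msmoothZ (c : R) F : msmooth F -> msmooth (fun x => c *: F x).
Proof.
move=> pF p q; have := psmoothZ c (pF p q).
by congr psmooth; apply/funext => x; rewrite /entry mxE.
Qed.

Lemma msmooth_sum (I : Type) (r : seq I) (F : I -> E -> M) :
  (forall k, msmooth (F k)) -> msmooth (fun x => \sum_(k <- r) F k x).
Proof.
move=> pF p q; have := psmooth_sum r (fun k => pF k p q).
by congr psmooth; apply/funext => x; rewrite /entry summxE.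
Qed.

Lemma msmooth0 : msmooth (fun=> 0).
Proof.
move=> p q; have := @psmooth0 R.
by congr psmooth; apply/funext => x; rewrite /entry mxE.
Qed.

End MatrixFunctions.

Section Equivariance.
Local Open Scope classical_set_scope.
Local Open Scope ring_scope.
Context {R : realType}.
Notation E := 'rV[R]_8.
Notation M := 'M[R]_7.
Variables (rho : (E -> E) -> M) (rho_rep : representation rho).
Implicit Types (F G : E -> M) (x : E) (i : 'I_8) (c : ('I_8 -> bool) -> R).

(* [c] is the sign by which a map with linear part diag((-1)^b) acts on dx_I. *)
Definition eqv c F := forall b t, pi1orb (saff b t) -> forall x,
  c b *: F (saff b t x) = rho (saff b t) *m F x *m invmx (rho (saff b t)).

Lemma eqvZ c (a : R) F : eqv c F -> eqv c (fun x => a *: F x).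
Proof.
move=> eF b t g x; rewrite scalerA mulrC -scalerA eF//.
by rewrite -scalemxAr -scalemxAl.
Qed.

Lemma eqv0 c : eqv c (fun=> 0).
Proof. by move=> b t _ x; rewrite scaler0 mulmx0 mul0mx. Qed.

Lemma eqv_sum c (I : Type) (r : seq I) (F : I -> E -> M) :
  (forall k, eqv c (F k)) -> eqv c (fun x => \sum_(k <- r) F k x).
Proof.
move=> eF b t g x; rewrite scaler_sumr mulmx_sumr mulmx_suml.
by apply: eq_bigr => k _; exact: eF.
Qed.

Lemma eqv_ext c c' F : c =1 c' -> eqv c F -> eqv c' F.
Proof. by move=> cc eF b t g x; rewrite -cc eF. Qed.

Lemma mul3_entry (A B C : M) p q : (A *m B *m C) p q =
  \sum_(k : 'I_7 * 'I_7) (A p k.1 * C k.2 q) * B k.1 k.2.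
Proof.
rewrite -(pair_bigA _ (fun k1 k2 => A p k1 * C k2 q * B k1 k2)) exchange_big mxE.
apply: eq_bigr => k2 _; rewrite mxE mulr_suml; apply: eq_bigr => k1 _.
by rewrite mulrAC.
Qed.

Lemma eqv_entry c F b t p q x : eqv c F -> pi1orb (saff b t) ->
  c b * entry p q F (saff b t x) =
  \sum_(k : 'I_7 * 'I_7) (rho (saff b t) p k.1 * invmx (rho (saff b t)) k.2 q) * entry k.1 k.2 F x.
Proof.
move=> eF g; have /matrixP/(_ p q) := eF b t g x.
by rewrite mul3_entry mxE.
Qed.

Lemma eqv_of_entry c F : (forall b t p q x, pi1orb (saff b t) ->
  c b * entry p q F (saff b t x) =
  \sum_(k : 'I_7 * 'I_7) (rho (saff b t) p k.1 * invmx (rho (saff b t)) k.2 q) * entry k.1 k.2 F x) ->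
  eqv c F.
Proof.
move=> H b t g x; apply/matrixP => p q; rewrite mul3_entry mxE.
exact: (H b t p q x g).
Qed.

(** By entries, equivariance is a linear relation with constant coefficients between F composed with
    [saff b t] and F, and such relations are preserved by T. *)
Lemma eqv_mx_op T c F : goodop T -> msmooth F -> eqv c F -> eqv c (mx_op T F).
Proof.
move=> gT pF eF; apply: eqv_of_entry => b t p q x g; rewrite entry_mx_op.
have ps := psmooth_saff b t (pF p q).
have := goodZ gT (c b) ps; rewrite (good_saff gT)// => /(congr1 (@^~ x)) /= <-.
have -> : (fun y => c b * entry p q F (saff b t y)) = fun y => \sum_(k : 'I_7 * 'I_7)
   (rho (saff b t) p k.1 * invmx (rho (saff b t)) k.2 q) * entry k.1 k.2 F y.
  by apply/funext => y; exact: eqv_entry.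
rewrite (good_sum gT _ (fun k : 'I_7 * 'I_7 => rho (saff b t) p k.1 * invmx (rho (saff b t)) k.2 q)
   (F := fun k => entry k.1 k.2 F)); last by move=> k; exact: pF.
by apply: eq_bigr => k _; rewrite entry_mx_op.
Qed.

Lemma eqv_partial c F i : smooth F -> eqv c F ->
  eqv (fun b => (-1) ^+ b i * c b) (partial i F).
Proof.
move=> sF eF; apply: eqv_of_entry => b t p q x g; rewrite entry_partial//.
have dF k l y : differentiable (entry k l F) y by exact: smooth_diff (smooth_entry k l sF).
rewrite mulrAC -(partial_saff _ (dF p q _)) mulrC.
have ds : differentiable (fun y => entry p q F (saff b t y)) x.
  exact: smooth_diff (smooth_saff b t (smooth_entry p q sF)).
have := partial_lin (c b) i ds (smooth_diff x (@psmooth0 R).1).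
rewrite [X in _ + X]partial_cst addr0 => <-.
have -> : (fun y => c b * entry p q F (saff b t y) + 0) = fun y => \sum_(k : 'I_7 * 'I_7)
   (rho (saff b t) p k.1 * invmx (rho (saff b t)) k.2 q) * entry k.1 k.2 F y.
  by apply/funext => y; rewrite addr0; exact: eqv_entry.
rewrite (partial_sum _ (fun k : 'I_7 * 'I_7 => rho (saff b t) p k.1 * invmx (rho (saff b t)) k.2 q)
   (F := fun k => entry k.1 k.2 F)); last by move=> k y; exact: dF.
by apply: eq_bigr => k _; rewrite entry_partial.
Qed.

Definition skew F := forall x, (F x)^T = - F x.

Lemma skew_entry F p q : skew F -> entry q p F = fun x => - entry p q F x.
Proof.
by move=> kF; apply/funext => x; have /matrixP/(_ p q) := kF x; rewrite !mxE.
Qed.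

Lemma skew_mx_op T F : goodop T -> msmooth F -> skew F -> skew (mx_op T F).
Proof.
move=> gT pF kF x; apply/matrixP => p q; rewrite !mxE (skew_entry p q kF).
have := goodZ gT (-1) (pF p q).
rewrite (_ : (fun y => _) = fun y => - entry p q F y); last by apply/funext => y; rewrite mulN1r.
by move=> ->; rewrite mulN1r.
Qed.

Lemma skew_partial F i : smooth F -> skew F -> skew (partial i F).
Proof.
move=> sF kF x; apply/matrixP => p q; rewrite !mxE.
have dF k l : differentiable (entry k l F) x by exact: smooth_diff (smooth_entry k l sF).
rewrite -!(pd_entry _ _ _ (sF [::] x)) (skew_entry p q kF).
have := partial_lin (-1) i (dF p q) (smooth_diff x (@psmooth0 R).1).
rewrite [X in _ + X]partial_cst addr0 mulN1r => <-; congr (pd i _ x).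
by apply/funext => y; rewrite mulN1r addr0.
Qed.

Lemma skewZ (a : R) F : skew F -> skew (fun x => a *: F x).
Proof. by move=> kF x; rewrite linearZ /= kF scalerN. Qed.

Lemma skew_sum (I : Type) (r : seq I) (F : I -> E -> M) :
  (forall k, skew (F k)) -> skew (fun x => \sum_(k <- r) F k x).
Proof.
by move=> kF x; rewrite linear_sum -sumrN; apply: eq_bigr => k _; exact: kF.
Qed.

Lemma rho_orth g : pi1orb g -> rho g *m (rho g)^T = 1%:M.
Proof. by move=> /rho_rep.1[]. Qed.

Lemma rho_unit g : pi1orb g -> rho g \in unitmx.
Proof. by move=> /rho_orth H; case: (mulmx1_unit H). Qed.

Lemma rho_id : rho id = 1%:M.
Proof.
have pid := @pi1orb_id R; have := rho_rep.2 _ _ pid pid.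
rewrite -[id \o id]/(@id E) => H.
by rewrite -(mulmxK (rho_unit pid) (rho id)) -H mulmxV// rho_unit.
Qed.

Hypotheses (rho_alpha : rho (@orb_alpha R) = 1%:M) (rho_beta : rho (@orb_beta R) = 1%:M).

(** Let f be whichever of alpha and beta reflects x_i. The composite f tau_i is an involution, and
    rho does not see f. *)
Lemma rho_tau_sqr i : rho (orb_tau i) *m rho (orb_tau i) = 1%:M.
Proof.
pose f := if (i < 4)%N then @orb_alpha R else @orb_beta R.
have pf : pi1orb f by rewrite /f; case: ifP => _; [exact: pi1orb_alpha|exact: pi1orb_beta].
have rf : rho f = 1%:M by rewrite /f; case: ifP.
have pt := @pi1orb_tau R i.
have pft := pi1orb_comp pf pt.
have := rho_rep.2 _ _ pft pft.
rewrite (rho_rep.2 _ _ pf pt) rf !mul1mx => <-; rewrite -rho_id; congr rho.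
apply/funext => x; apply/rowP => j; rewrite /f /=.
have [->|ji] := eqVneq j i.
  by case: i {f pf rf pt pft} => -[|[|[|[|[|[|[|[|//]]]]]]]] i8; rewrite /orb_tau /= !mxE ?eqxx /=; ring.
rewrite /orb_tau; case: ifP => _;
by case: j ji => -[|[|[|[|[|[|[|[|//]]]]]]]] j8 ji; rewrite !mxE (negbTE ji) /=; ring.
Qed.

(** Translating twice along e_i conjugates by the square of an involution, whence the period 2. The
    condition on [c] says that translations act without a sign. *)
Lemma eqv_msmooth c F : c (fun=> false) = 1 -> smooth F -> eqv c F -> msmooth F.
Proof.
move=> c1 sF eF p q; split; first exact: smooth_entry.
move=> i x; have pt := @pi1orb_tau R i; have st := rho_tau_sqr i.
have ut := rho_unit pt.
have inv : invmx (rho (orb_tau i)) = rho (orb_tau i).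
  by rewrite -[LHS]mul1mx -st mulmxK.
have step y : F (y + delta_mx 0 i) = rho (orb_tau i) *m F y *m rho (orb_tau i).
  have := eF (fun=> false) (delta_mx 0 i); rewrite -orb_tauE => /(_ pt y).
  by rewrite c1 scale1r inv.
rewrite /entry scaler_nat mulr2n addrA !step !mulmxA st mul1mx.
by rewrite -mulmxA st mulmx1.
Qed.

End Equivariance.

(** * Skew matrices commuting with a family of simple joint spectrum *)

Section Centralizer.
Local Open Scope classical_set_scope.
Local Open Scope ring_scope.
Context {R : realFieldType} {n : nat}.
Implicit Types (N P X : 'M[R]_n).

Lemma comm_diag_entry N (d : 'rV[R]_n) p q :
  diag_mx d *m N = N *m diag_mx d -> d 0 p != d 0 q -> N p q = 0.
Proof.
move=> /matrixP/(_ p q); rewrite mul_diag_mx mul_mx_diag !mxE => H dpq.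
apply/eqP; have /eqP := H; rewrite mulrC -subr_eq0 -mulrBr mulf_eq0 subr_eq0 (negbTE dpq) orbF.
by [].
Qed.

(* The rows of P are eigenvectors of commuting symmetric matrices for pairwise
   different joint eigenvalues, hence orthogonal: P P^T and P X P^-1 are both
   diagonal, while their product P X P^T is skew. *)
Lemma skew_centralizer0 (I : Type) (A : I -> 'M[R]_n) (d : I -> 'rV[R]_n) P X :
  P \in unitmx -> (forall k, (A k)^T = A k) ->
  (forall k, P *m A k *m invmx P = diag_mx (d k)) ->
  (forall p q, p != q -> exists k, d k 0 p != d k 0 q) ->
  X^T = - X -> (forall k, A k *m X = X *m A k) -> X = 0.
Proof.
move=> uP sA PA sep skX cX.
pose N := P *m X *m invmx P; pose S := P *m P^T.
have PAk k : P *m A k = diag_mx (d k) *m P by rewrite -PA mulmxKV.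
have APk k : A k *m P^T = P^T *m diag_mx (d k).
  by rewrite -(sA k) -trmx_mul PAk trmx_mul tr_diag_mx.
have Nd p q : p != q -> N p q = 0.
  move=> /sep[k]; apply: comm_diag_entry.
  have dV : invmx P *m diag_mx (d k) = A k *m invmx P by rewrite -PA -!mulmxA mulKmx.
  by rewrite /N !mulmxA -PAk -[in RHS]mulmxA dV -!mulmxA; congr (_ *m _); rewrite !mulmxA cX.
have Sd p q : p != q -> S p q = 0.
  move=> /sep[k]; apply: comm_diag_entry.
  by rewrite /S mulmxA -PAk -mulmxA APk mulmxA.
have NS : N *m S = P *m X *m P^T by rewrite /N /S mulmxA mulmxKV.
have NSk : (N *m S)^T = - (N *m S).
  by rewrite NS !trmx_mul trmxK skX mulNmx mulmxN mulmxA.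
have NS0 : N *m S = 0.
  apply/matrixP => p q; rewrite [RHS]mxE; have [->|pq] := eqVneq p q.
    have /matrixP/(_ q q) := NSk; rewrite !mxE => /eqP; rewrite -subr_eq0 opprK -mulr2n.
    by rewrite mulrn_eq0 /= => /eqP.
  rewrite mxE big1// => k _; have [<-|kq] := eqVneq p k; first by rewrite Sd ?mulr0.
  by rewrite Nd ?mul0r.
have uS : P^T \in unitmx by rewrite unitmx_tr.
have PXP : P *m X *m P^T = 0 by rewrite -NS.
by rewrite -[X](mulKmx uP) -[P *m X](mulmxK uS) PXP mul0mx mulmx0.
Qed.

End Centralizer.

(** * Vanishing of mean values and of H^0 *)

Section Acyclic.
Local Open Scope classical_set_scope.
Local Open Scope ring_scope.
Context {R : realType}.
Notation E := 'rV[R]_8.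
Notation M := 'M[R]_7.
Variables (rho : (E -> E) -> M) (rho_rep : representation rho).
Hypotheses (rho_alpha : rho (@orb_alpha R) = 1%:M) (rho_beta : rho (@orb_beta R) = 1%:M).
Hypothesis rho_tau : exists P : M, P \in unitmx /\
      [/\ P *m rho (@orb_tau R (idx 4)) *m invmx P
            = diag7 [:: -1; -1; -1; -1; 1; 1; 1],
          P *m rho (@orb_tau R (idx 5)) *m invmx P
            = diag7 [:: -1; -1; 1; 1; -1; -1; 1] &
          P *m rho (@orb_tau R (idx 8)) *m invmx P
            = diag7 [:: 1; -1; -1; 1; 1; -1; -1]].
Implicit Types (F : E -> M) (x : E) (i : 'I_8) (c : ('I_8 -> bool) -> R).

(** The three given diagonals, with [true] for -1. The columns are the seven nonzero vectors of
    F_2^3, each once, so the joint eigenvalues are pairwise different. *)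
Definition sign_rows : seq (seq bool) :=
  [:: [:: true; true; true; true; false; false; false];
      [:: true; true; false; false; true; true; false];
      [:: false; true; true; false; false; true; true]].

Lemma sign_rows_sep p q : p \in iota 0 7 -> q \in iota 0 7 -> p != q ->
  has (fun r => nth false r p != nth false r q) sign_rows.
Proof.
move=> p7 q7; apply/implyP; move: q q7; apply: all_mem; move: p p7.
by apply: all_mem; vm_compute.
Qed.

Lemma skew_fixed_by_tau0 (X : M) : X^T = - X ->
  (forall i, rho (orb_tau i) *m X *m invmx (rho (orb_tau i)) = X) -> X = 0.
Proof.
move=> skX fX; have [P [uP [P4 P5 P8]]] := rho_tau.
pose A (k : 'I_3) := rho (orb_tau (nth (idx 4) [:: idx 4; idx 5; idx 8] k)).
pose d (k : 'I_3) : 'rV[R]_7 := \row_j (-1) ^+ nth false (nth [::] sign_rows k) j.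
apply: (@skew_centralizer0 _ _ _ A d P) => //.
(* An orthogonal involution is symmetric. *)
- move=> k; rewrite /A; set i := nth _ _ _.
  have ut := rho_unit rho_rep (@pi1orb_tau R i).
  have := rho_tau_sqr rho_rep rho_alpha rho_beta i.
  by rewrite -(rho_orth rho_rep (@pi1orb_tau R i)) => /(can_inj (mulKmx ut)).
- have dE (s : seq R) (r : seq bool) : (forall j : 'I_7, s`_j = (-1) ^+ nth false r j) ->
     diag7 s = diag_mx (\row_j (-1) ^+ nth false r j).
    by move=> H; congr diag_mx; apply/rowP => j; rewrite !mxE.
  case=> -[|[|[|//]]] k3; rewrite /A /d /=.
  + rewrite P4; apply: dE; by case=> -[|[|[|[|[|[|[|//]]]]]]] j7; rewrite /= ?expr1 ?expr0.
  + rewrite P5; apply: dE; by case=> -[|[|[|[|[|[|[|//]]]]]]] j7; rewrite /= ?expr1 ?expr0.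
  + rewrite P8; apply: dE; by case=> -[|[|[|[|[|[|[|//]]]]]]] j7; rewrite /= ?expr1 ?expr0.
- move=> p q pq; have := @sign_rows_sep p q; rewrite !mem_iota !ltn_ord => /(_ isT isT pq).
  move=> /hasP[r rS rpq]; have rI := rS; rewrite -index_mem in rI.
  exists (Ordinal rI); rewrite !mxE /= nth_index//.
  have N1 : (-1 : R) < 1 by lra.
  by move: (nth false r p) (nth false r q) rpq => [] [] // _; rewrite ?expr1 ?expr0 ?(lt_eqF N1) ?(gt_eqF N1).
move=> k; rewrite /A; set i := nth _ _ _.
by have ut := rho_unit rho_rep (@pi1orb_tau R i); rewrite -[in RHS](fX i) mulmxKV.
Qed.

(** The entrywise mean is again skew and equivariant, and it is constant, so equivariance under
    tau_i says that it is fixed by conjugation with rho (tau_i). *)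
Lemma mean_eqv0 c F p q : c (fun=> false) = 1 -> msmooth F -> skew F -> eqv rho c F ->
  mean_op (entry p q F) = fun=> 0.
Proof.
move=> c1 pF kF eF; apply/funext => x.
have eM := eqv_mx_op (good_mean_op (R := R)) pF eF; have kM := skew_mx_op (good_mean_op (R := R)) pF kF.
suff M0 : mx_op mean_op F x = 0 by have /matrixP/(_ p q) := M0; rewrite !mxE.
apply: skew_fixed_by_tau0; first exact: kM.
move=> i; have pt := @pi1orb_tau R i; move: (pt); rewrite orb_tauE => pt'.
rewrite -(eM _ _ pt' x) c1 scale1r saff_shift.
by apply/matrixP => k l; rewrite !mxE mean_op_cst//; exact: pF.
Qed.

Lemma green_op_Lap_eqv c F p q : c (fun=> false) = 1 -> msmooth F -> skew F -> eqv rho c F ->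
  green_op (Lap (entry p q F)) = entry p q F.
Proof.
move=> c1 pF kF eF; apply/funext => x; rewrite green_op_Lap; last exact: pF.
by rewrite (mean_eqv0 p q c1 pF kF eF) subr0.
Qed.

Lemma form_sign_false (I : {set 'I_8}) : form_sign (fun=> false) I = 1 :> R.
Proof. by rewrite /form_sign big1. Qed.

Lemma Ad_eqv k a I : Ad_forms rho k a -> eqv rho (fun b => form_sign b I) (fun x => a x I).
Proof.
move=> [_ _ _ eqa] b t g x; rewrite -pullback_saff; exact: eqa.
Qed.

Lemma Ad_skew k a I : Ad_forms rho k a -> skew (fun x => a x I).
Proof. by move=> [_ _ sa _] x; exact: sa. Qed.

Lemma Ad_msmooth k a I : Ad_forms rho k a -> msmooth (fun x => a x I).
Proof.
move=> Aa; apply: (eqv_msmooth rho_rep rho_alpha rho_beta (form_sign_false I)); last exact: Ad_eqv Aa.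
by case: Aa.
Qed.

Lemma Ad_forms_intro k (a : E -> Defs.form M) :
  (forall I, msmooth (fun x => a x I)) -> (forall x, of_degree k (a x)) ->
  (forall I, skew (fun x => a x I)) ->
  (forall I, eqv rho (fun b => form_sign b I) (fun x => a x I)) -> Ad_forms rho k a.
Proof.
move=> sa da ka ea; split=> //.
- by move=> I; exact: msmooth_smooth.
- by move=> x I; exact: ka.
by move=> g pg x I; have [b [t gE]] := pi1orb_saff pg; rewrite gE in pg *; rewrite pullback_saff ea.
Qed.

Lemma acyclic0 : irreducible rho.
Proof.
move=> a [Aa /= ea]; apply/funext => x; apply/ffunP => I; rewrite [RHS]ffunE.
have [I0|I0] := eqVneq #|I| 0%N; last by case: Aa => _ ->.
have -> : I = finset.set0 by apply/eqP; rewrite -cards_eq0 I0.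
apply/matrixP => p q; rewrite [RHS]mxE.
have pF := Ad_msmooth finset.set0 Aa.
have := green_op_Lap_eqv p q (form_sign_false _) pF (Ad_skew finset.set0 Aa) (Ad_eqv finset.set0 Aa).
set u := entry p q _ => /(congr1 (@^~ x)) Gu; apply: etrans (esym Gu) _ => /=.
have -> : Lap u = fun=> 0.
  apply/funext => y; rewrite /Lap big1// => i _.
  rewrite (_ : pd i u = fun=> 0); first exact: partial_cst.
  apply/funext => z; rewrite /u pd_entry; last exact: (msmooth_smooth pF [::]).
  by have := congr1 (fun b : E -> Defs.form M => b z [set i]%SET) ea; rewrite extd_set1 => ->; rewrite ffunE mxE.
by rewrite (good0 (good_green_op (R := R))).
Qed.

End Acyclic.

(** * The complex *)

Section ScalarIdentities.
Local Open Scope classical_set_scope.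
Local Open Scope ring_scope.
Context {R : realType}.
Notation E := 'rV[R]_8.
Notation o n := (inord n : 'I_8).
Implicit Types (u : nat -> E -> R) (x : E) (k : seq nat).

Definition hessian u x (t : nat * nat * nat) : R := pd (o t.1.1) (pd (o t.1.2) (u t.2)) x.

Lemma hessian_srt u x i j g : psmooth (u g) -> hessian u x (srt i j g) = pd (o i) (pd (o j) (u g)) x.
Proof.
move=> pu; rewrite /hessian /srt /=; have [ij|ij] := leqP i j.
  by [].
by rewrite (clairaut _ _ pu).
Qed.

Lemma sum_iota8 (V : nmodType) (F : 'I_8 -> V) : \sum_(j <- iota 0 8) F (o j) = \sum_(j < 8) F j.
Proof.
rewrite -[iota 0 8]/(index_iota 0 8) big_mkord.
by apply: eq_bigr => j _; rewrite inord_val.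
Qed.

Lemma ev_lapL u x g : ev (hessian u x) (lapL g) = Lap (u g) x.
Proof. by rewrite /ev big_map /Lap -(sum_iota8 (fun j => pd j (pd j (u g)) x)). Qed.

Lemma pdZ (a : R) (v : E -> R) i x : psmooth v -> pd i (fun y => a * v y) x = a * pd i v x.
Proof.
move=> pv; have := partial_lin a i (smooth_diff x pv.1) (smooth_diff x (@psmooth0 R).1).
rewrite [X in _ + X]partial_cst addr0 => <-; congr (pd i _ x).
by apply/funext => y; rewrite addr0.
Qed.

Lemma pd_ev (I : Type) (W : I -> E -> R) (L : seq (bool * I)) (i : 'I_8) x : (forall l, psmooth (W l)) ->
  pd i (fun y => ev (fun l => W l y) L) x = ev (fun l => pd i (W l) x) L.
Proof.
move=> pW.
have evE (w : I -> R) : ev w L = \sum_(q <- L) (-1) ^+ q.1 * w q.2.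
  by apply: eq_bigr => -[[] q] _ /=; rewrite ?expr1 ?expr0 ?mulN1r ?mul1r.
rewrite evE -(partial_sum _ (fun q : bool * I => (-1) ^+ q.1) (F := fun q => W q.2)).
  by congr (pd i _ x); apply/funext => y; exact: evE.
by move=> q y; exact: smooth_diff (pW q.2).1.
Qed.

Definition dpair u k x : R :=
  pd (o (nth 0%N k 0)) (u (nth 0%N k 1)) x - pd (o (nth 0%N k 1)) (u (nth 0%N k 0)) x.

Lemma psmooth_dpair u k : (forall n, psmooth (u n)) -> psmooth (dpair u k).
Proof. by move=> pu; apply: psmoothB; exact: psmooth_partial. Qed.

Lemma ev_dextL u n k x : (forall g, psmooth (u g)) ->
  ev (hessian u x) (dextL n k) = pd (o n) (dpair u k) x.
Proof.
move=> pu; rewrite /ev !big_cons big_nil /= addr0 !hessian_srt//.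
set i := nth _ _ _; set j := nth _ _ _.
have d1 := smooth_diff x (psmooth_partial (o j) (pu i)).1.
have d2 := smooth_diff x (psmooth_partial (o i) (pu j)).1.
have := partial_lin (-1) (o n) d1 d2; rewrite mulN1r addrC => <-.
by congr (pd _ _ x); apply/funext => y; rewrite mulN1r addrC.
Qed.

Lemma pair_in_pairs i j : (i < j < 8)%N -> [:: i; j] \in pairs.
Proof.
move=> /andP[ij j8]; rewrite mem_filter; apply/andP; split; first by rewrite /= ij.
apply: (allpairs_f (fun i j => [:: i; j])); rewrite mem_iota //=.
exact: ltn_trans ij j8.
Qed.

Lemma pairs_eta k : k \in pairs ->
  (k == [:: nth 0%N k 0; nth 0%N k 1]) && (nth 0%N k 0 < nth 0%N k 1 < 8)%N.
Proof. by move: k; apply: all_mem; vm_compute. Qed.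

Lemma dirac_terms_pairs k q : k \in pairs -> q \in dirac_terms k -> q.2 \in pairs.
Proof. by move=> kp; rewrite inE => /predU1P[->//|]; exact: starOmega_terms_pairs. Qed.

(** Every term of [dirac_sqr1] outside its first block is, up to sign, a derivative of a component
    of D u, and these components vanish by assumption. *)
Lemma Lap_of_closed u i x : (forall g, psmooth (u g)) ->
  (forall y k, k \in pairs -> ev (fun k => dpair u k y) (dirac_terms k) = 0) -> i \in iota 0 8 ->
  Lap (u i) x = \sum_(j <- iota 0 8) pd (o i) (pd (o j) (u j)) x.
Proof.
move=> pu H i8; rewrite -ev_lapL (ev_eqL _ (dirac_sqr1 i8)) ev_cat.
have -> : ev (hessian u x) [seq (false, srt i j j) | j <- iota 0 8] =
   \sum_(j <- iota 0 8) pd (o i) (pd (o j) (u j)) x.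
  by rewrite /ev big_map; apply: eq_bigr => j _; rewrite /= hessian_srt.
rewrite -[RHS]addr0; congr (_ + _).
rewrite /ev big_flatten big_map big_seq; apply: big1 => k k8.
have i8' : (i < 8)%N by move: i8; rewrite mem_iota.
have k8' : (k < 8)%N by move: k8; rewrite mem_iota.
have Z l : l \in pairs -> ev (hessian u x) (bind (dirac_terms l) (dextL k)) = 0.
  move=> lp; rewrite ev_bind.
  have -> : (fun l' => ev (hessian u x) (dextL k l')) = fun l' => pd (o k) (dpair u l') x.
    by apply/funext => l'; exact: ev_dextL.
  rewrite -pd_ev; last by move=> l'; exact: psmooth_dpair.
  rewrite (_ : (fun y => _) = fun=> 0); first exact: partial_cst.
  by apply/funext => y; exact: H.
case: ltngtP => [ki|ik|_]; last by rewrite big_nil.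
- by apply: Z; rewrite pair_in_pairs// ki.
- rewrite -[LHS]/(ev (hessian u x) (sgnL true _)) ev_sgnL Z ?oppr0//.
  by rewrite pair_in_pairs// ik.
Qed.

Lemma ev_entry (I : Type) m n (f : I -> 'M[R]_(m, n)) L p q :
  ev f L p q = ev (fun l => f l p q) L.
Proof. by rewrite /ev summxE; apply: eq_bigr => -[[] i] _ //=; rewrite mxE. Qed.

Lemma P27_entry m n (w : Defs.form 'M[R]_(m, n)) k p q : k \in pairs ->
  P27 w (set_of_seq k) p q = 4%:R^-1 * ev (fun k => w (set_of_seq k) p q) (dirac_terms k).
Proof.
move=> kp; rewrite /P27 formZ formD !mxE starOmega_pair// ev_entry; congr (_ * _).
by rewrite /ev big_cons.
Qed.

(** On Lambda^2_7 the row [dirac_terms l] evaluates to four times component l, so rows that agree up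
    to sign give components that agree up to the same sign. *)
Lemma Lambda27_rep (V : lmodType R) (w : Defs.form V) k : Lambda27 w -> k \in pairs ->
  w (set_of_seq k) = (-1) ^+ (rep27 k).1 *: w (set_of_seq [:: 0%N; (rep27 k).2]).
Proof.
move=> [w2 /= wT] kp.
have H l : l \in pairs -> ev (at_pair w) (dirac_terms l) = 4%:R *: w (set_of_seq l).
  move=> lp; rewrite /ev big_cons -/(ev (at_pair w) (starOmega_terms l)) -starOmega_pair// [starOmega w]wT formZ /=.
  by rewrite !scaler_nat -mulrS.
have := ev_eqL (at_pair w) (dirac_terms_rep kp); rewrite ev_sgnL !H//; last exact: rep27_pairs.
rewrite signZ => E; apply: (@scalerI _ _ 4%:R); first by rewrite pnatr_eq0.
by rewrite E; case: (rep27 k).1; rewrite ?scalerN.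
Qed.

End ScalarIdentities.

(** * Vanishing of H^1 and H^2 *)

Section Complex.
Local Open Scope classical_set_scope.
Local Open Scope ring_scope.
Context {R : realType}.
Notation E := 'rV[R]_8.
Notation M := 'M[R]_7.
Notation o n := (inord n : 'I_8).

Definition form0 (f : E -> M) (x : E) : Defs.form M :=
  [ffun I : {set 'I_8} => if I == finset.set0 then f x else 0].
Definition form1 (al : 'I_8 -> E -> M) (x : E) : Defs.form M :=
  [ffun I : {set 'I_8} => if [pick n | I == [set n]%SET] is Some n then al n x else (0 : M)].

Lemma form1_set1 al x n : form1 al x [set n]%SET = al n x.
Proof.
rewrite ffunE; case: pickP => [k /eqP/finset.set1_inj ->//|/(_ n)].
by rewrite eqxx.
Qed.

Lemma form1_cases al I : (exists n, (fun x => form1 al x I) = al n /\ I = [set n]%SET) \/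
  (fun x => form1 al x I) = fun=> 0.
Proof.
case E : [pick n | I == [set n]%SET] => [n|]; [left; exists n|right].
  have I1 : I = [set n]%SET by move: E; case: pickP => // k /eqP -> [<-].
  by split=> //; apply/funext => x; rewrite I1 form1_set1.
by apply/funext => x; rewrite ffunE E.
Qed.

Lemma extd_entry (a : E -> Defs.form M) k p q x : k \in pairs ->
  (forall I, smooth (fun y => a y I)) ->
  extd a x (set_of_seq k) p q = dpair (fun n => entry p q (fun y => a y [set o n]%SET)) k x.
Proof.
move=> /pairs_eta/andP[/eqP kE k8] sa; rewrite [in LHS]kE extd_pair//.
rewrite mxE [X in _ + X]mxE /dpair !pd_entry//; exact: (sa _ [::]).
Qed.

Variables (rho : (E -> E) -> M) (rho_rep : representation rho).
Hypotheses (rho_alpha : rho (@orb_alpha R) = 1%:M) (rho_beta : rho (@orb_beta R) = 1%:M).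
Hypothesis rho_tau : exists P : M, P \in unitmx /\
      [/\ P *m rho (@orb_tau R (idx 4)) *m invmx P
            = diag7 [:: -1; -1; -1; -1; 1; 1; 1],
          P *m rho (@orb_tau R (idx 5)) *m invmx P
            = diag7 [:: -1; -1; 1; 1; -1; -1; 1] &
          P *m rho (@orb_tau R (idx 8)) *m invmx P
            = diag7 [:: 1; -1; -1; 1; 1; -1; -1]].

Lemma form_sign_set1 b i : form_sign b [set i]%SET = (-1) ^+ b i :> R.
Proof. by rewrite /form_sign big_set1. Qed.

Lemma form_sign_set2 b i j : i != j -> form_sign b [set i; j]%SET = (-1) ^+ b i * (-1) ^+ b j :> R.
Proof. by move=> ij; rewrite /form_sign big_setU1 ?inE// big_set1. Qed.

Lemma sign_sqr (b : bool) (a : R) : (-1) ^+ b * ((-1) ^+ b * a) = a.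
Proof. by rewrite mulrA -expr2 sqrr_sign mul1r. Qed.

Lemma Ad0_intro f : msmooth f -> skew f -> eqv rho (fun=> 1) f -> Ad_forms rho 0 (form0 f).
Proof.
move=> pf kf ef.
have H I : (fun x => form0 f x I) = if I == finset.set0 then f else fun=> 0.
  by apply/funext => x; rewrite ffunE; case: ifP.
apply: Ad_forms_intro => [I|x I|I|I].
- by rewrite H; case: ifP => _ //; exact: msmooth0.
- by rewrite ffunE cards_eq0 => /negbTE ->.
- by rewrite H; case: ifP => _ // x; rewrite trmx0 oppr0.
rewrite H; case: eqP => [->|_]; last exact: eqv0.
by apply: eqv_ext ef => b; rewrite /form_sign big_set0.
Qed.

Lemma Ad1_intro al : (forall n, msmooth (al n)) -> (forall n, skew (al n)) ->
  (forall n, eqv rho (fun b => (-1) ^+ b n) (al n)) -> Ad_forms rho 1 (form1 al).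
Proof.
move=> pf kf ef.
apply: Ad_forms_intro => [I|x I|I|I].
- by have [[n [-> _]]|->] := form1_cases al I => //; exact: msmooth0.
- move=> I1; rewrite ffunE; case: pickP => // n /eqP E.
  by move: I1; rewrite E cards1.
- by have [[n [-> _]]|->] := form1_cases al I => // x; rewrite trmx0 oppr0.
have [[n [-> ->]]|->] := form1_cases al I; last exact: eqv0.
by apply: eqv_ext (ef n) => b; rewrite form_sign_set1.
Qed.

Lemma acyclic1 : infinitesimally_rigid rho.
Proof.
move=> a [Aa /= pa].
pose A i (x : E) : M := a x [set i]%SET.
have pA i : msmooth (A i) by exact: (Ad_msmooth rho_rep rho_alpha rho_beta [set i]%SET Aa).
have kA i : skew (A i) by exact: Ad_skew Aa.
have eA i : eqv rho (fun b => (-1) ^+ b i) (A i).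
  by apply: eqv_ext (Ad_eqv [set i]%SET Aa) => b; rewrite form_sign_set1.
have sA i := msmooth_smooth (pA i).
pose S x := \sum_(i < 8) partial i (A i) x.
have pS : msmooth S by apply: msmooth_sum => i; exact: msmooth_partial.
have kS : skew S by apply: skew_sum => i; exact: skew_partial.
(* The sign of component i and the sign picked up by d_i cancel, so S transforms as a section of Ad
   E_0. *)
have eS : eqv rho (fun=> 1) S.
  apply: eqv_sum => i; apply: eqv_ext (eqv_partial i (sA i) (eA i)) => b.
  by rewrite -[_ ^+ _ in X in _ * X]mulr1 sign_sqr.
have gG := good_green_op (R := R).
exists (form0 (mx_op green_op S)).
  by apply: Ad0_intro; [exact: msmooth_mx_op|exact: skew_mx_op|exact: eqv_mx_op].
have da x : of_degree 1 (a x) by case: Aa.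
apply/funext => x; apply/ffunP => K.
have [K1|K1] := eqVneq #|K| 1%N; last first.
  rewrite da// (@extd_degree _ _ _ 0)// => y I.
  by rewrite ffunE cards_eq0 => /negbTE ->.
have /cards1P[i ->] := introT eqP K1; rewrite extd_set1.
rewrite (_ : (fun y => _) = mx_op green_op S); last by apply/funext => y; rewrite ffunE eqxx.
apply/matrixP => p q.
rewrite -pd_entry; last exact: (msmooth_smooth (msmooth_mx_op gG pS) [::]).
rewrite entry_mx_op (good_partial gG); last exact: pS.
(* Closedness of a enters here, as Lap a_i = d_i S; the Green operator then returns a_i because its
   mean is 0. *)
have <- : Lap (entry p q (A i)) = pd i (entry p q S).
  apply/funext => y.
  pose u n := entry p q (A (o n)).
  have pu g : psmooth (u g) by exact: pA.
  have -> : entry p q (A i) = u (val i) by rewrite /u inord_val.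
  rewrite Lap_of_closed//; last by rewrite mem_iota ltn_ord.
    have -> : entry p q S = fun y => \sum_(j < 8) 1 * pd j (entry p q (A j)) y.
      apply/funext => z; rewrite /entry summxE; apply: eq_bigr => j _.
      by rewrite mul1r pd_entry//; exact: (sA j [::]).
    rewrite partial_sum => [|j z]; last exact: smooth_diff (psmooth_partial j (pA j p q)).1.
    rewrite (sum_iota8 (fun j => pd (o (val i)) (pd j (entry p q (A j))) y)) inord_val.
    by apply: eq_bigr => j _; rewrite mul1r.
  move=> z k kp; have w2 : of_degree 2 (extd a z) by exact: extd_degree.
  have := congr1 (fun b : E -> Defs.form M => b z (set_of_seq k) p q) pa.
  rewrite /pi27_extd pi27E// P27_entry// ffunE mxE => /eqP.
  rewrite mulf_eq0 invr_eq0 pnatr_eq0 /= => /eqP <-.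
  apply: eq_big_seq => l lk; rewrite extd_entry//; first exact: dirac_terms_pairs kp lk.
  by case: Aa.
by rewrite (green_op_Lap_eqv rho_rep rho_alpha rho_beta rho_tau p q _ (pA i) (kA i) (eA i))// expr0.
Qed.

Lemma acyclic2 : unobstructed rho.
Proof.
move=> w [Aw wL].
pose F (K : {set 'I_8}) (x : E) : M := w x K.
have pF K : msmooth (F K) by exact: (Ad_msmooth rho_rep rho_alpha rho_beta K Aw).
have kF K : skew (F K) by exact: Ad_skew Aw.
have eF K : eqv rho (fun b => form_sign b K) (F K) by exact: Ad_eqv Aw.
have gG := good_green_op (R := R).
(* The components of w extended antisymmetrically to all ordered pairs, so that delta is a sum over
   all m. *)
pose ww (m n : 'I_8) : E -> M := if m == n then fun=> 0 else
  fun x => (if (m < n)%N then 1 else -1) *: F [set m; n]%SET x.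
have pw m n : msmooth (ww m n).
  by rewrite /ww; case: eqP => _; [exact: msmooth0|exact: msmoothZ].
have kw m n : skew (ww m n).
  by rewrite /ww; case: eqP => _; [move=> x; rewrite trmx0 oppr0|exact: skewZ].
have ew m n : eqv rho (fun b => (-1) ^+ b m * (-1) ^+ b n) (ww m n).
  rewrite /ww; case: eqVneq => mn; first exact: eqv0.
  by apply: eqvZ; apply: eqv_ext (eF [set m; n]%SET) => b; rewrite form_sign_set2.
pose vv m n := mx_op green_op (ww m n).
have pv m n : msmooth (vv m n) by exact: msmooth_mx_op.
(* The factor 4 compensates the 1/4 in [P27]. *)
pose al n x := 4%:R *: \sum_(m < 8) partial m (vv m n) x.
have pal n : msmooth (al n).
  by apply: msmoothZ; apply: msmooth_sum => m; exact: msmooth_partial.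
have Aal : Ad_forms rho 1 (form1 al).
  apply: Ad1_intro => // n.
    by apply/skewZ/skew_sum => m; apply: skew_partial; [exact: msmooth_smooth|exact: skew_mx_op].
  apply/eqvZ/eqv_sum => m.
  apply: eqv_ext (eqv_partial m (msmooth_smooth (pv m n)) (eqv_mx_op gG (pw m n) (ew m n))) => b.
  exact: sign_sqr.
exists (form1 al) => //.
have w2 x : of_degree 2 (w x) by have [] := wL x.
apply/funext => x.
have d2 : of_degree 2 (extd (form1 al) x) by apply: extd_degree; case: Aal.
rewrite /pi27_extd pi27E//; apply: degree2_eq => //; first by have [] := P27_Lambda27 d2.
move=> k kp; apply/matrixP => p q; rewrite P27_entry//.
(* As w lies in Lambda^2_7 everywhere and the Green operator commutes with signs, every off-diagonal
   entry of [vv] is a signed copy of one of these; this is the form in which [dirac_sqr27]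
   applies. *)
pose v g := green_op (entry p q (F (set_of_seq [:: 0%N; g]))).
have pvg g : psmooth (v g) by apply: good_psmooth => //; exact: pF.
pose ua n := entry p q (al (o n)).
have uaE : ua = fun n => entry p q (fun y => form1 al y [set o n]%SET).
  by apply/funext => n; apply/funext => y; rewrite /entry form1_set1.
have wwE m n y : (m < n < 8)%N -> F [set o m; o n]%SET y p q =
    (-1) ^+ (rep27 [:: m; n]).1 * entry p q (F (set_of_seq [:: 0%N; (rep27 [:: m; n]).2])) y.
  move=> mn; have := Lambda27_rep (wL y) (pair_in_pairs mn).
  have /andP[m_n n8] := mn; rewrite /F /entry -set_of_seq2//; last exact: ltn_trans m_n n8.
  by move=> ->; rewrite mxE.
have pd_sign (b : bool) g i m : pd (o i) (pd (o m) (green_op (fun y => (-1) ^+ b * entry p q (F (set_of_seq [:: 0%N; g])) y))) x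
    = if b then - pd (o i) (pd (o m) (v g)) x else pd (o i) (pd (o m) (v g)) x.
  rewrite goodZ//; last exact: pF.
  rewrite (_ : pd (o m) _ = fun y => (-1) ^+ b * pd (o m) (v g) y); last first.
    by apply/funext => y; exact: (pdZ _ _ _ (pvg g)).
  rewrite (pdZ _ _ _ (psmooth_partial (o m) (pvg g))).
  by case: b; rewrite ?expr1 ?expr0 ?mulN1r ?mul1r.
have uaD i j : (j < 8)%N -> pd (o i) (ua j) x = 4%:R * ev (hessian v x) (divL i j).
  move=> j8.
  have -> : ua j = fun y => \sum_(m < 8) 4%:R * pd m (entry p q (vv m (o j))) y.
    apply/funext => y; rewrite /ua /entry /al mxE summxE mulr_sumr; apply: eq_bigr => m _.
    by rewrite pd_entry//; exact: (msmooth_smooth (pv m (o j)) [::]).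
  rewrite partial_sum; last first.
    by move=> m z; exact: smooth_diff (psmooth_partial m (pv m (o j) p q)).1.
  rewrite -mulr_sumr; congr (_ * _).
  rewrite -(sum_iota8 (fun m => pd (o i) (pd m (entry p q (vv m (o j)))) x)).
  rewrite [RHS]/ev big_flatten big_map; apply: eq_big_seq => m; rewrite mem_iota => /andP[_ m8].
  rewrite entry_mx_op -[RHS]/(ev (hessian v x) _).
  have [->|mj] := eqVneq m j.
    rewrite /ww eqxx (_ : entry p q _ = fun=> 0); last by apply/funext => y; rewrite /entry mxE.
    rewrite good0// /ev big_nil (_ : pd (o j) _ = fun=> 0); first exact: partial_cst.
    by apply/funext => y; exact: partial_cst.
  have mj' : (o m == o j) = false by apply/negbTE; rewrite -val_eqE /= !inordK.
  have [lt_mj|lt_jm|E] := ltngtP m j; last by rewrite E eqxx in mj.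
  - rewrite (_ : entry p q _ = fun y => (-1) ^+ (rep27 [:: m; j]).1 * entry p q (F (set_of_seq [:: 0%N; (rep27 [:: m; j]).2])) y).
      by rewrite pd_sign /ev big_cons big_nil /= addr0 hessian_srt.
    by apply/funext => y; rewrite -wwE ?lt_mj// /ww mj' /entry !inordK// lt_mj scale1r.
  - rewrite (_ : entry p q _ = fun y => (-1) ^+ (~~ (rep27 [:: j; m]).1) * entry p q (F (set_of_seq [:: 0%N; (rep27 [:: j; m]).2])) y).
      by rewrite pd_sign /ev big_cons big_nil /= addr0 hessian_srt.
    apply/funext => y; rewrite signrN mulNr -wwE ?lt_jm// /ww mj' /entry !inordK// ltnNge (ltnW lt_jm) /=.
    by rewrite mxE mulN1r finset.setUC.
have -> : ev (fun k => extd (form1 al) x (set_of_seq k) p q) (dirac_terms k) = 4%:R * ev (hessian v x) (bind (dirac_terms k) ddivL).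
  rewrite ev_bind /ev mulr_sumr; apply: eq_big_seq => l /(dirac_terms_pairs kp) lp.
  have -> : extd (form1 al) x (set_of_seq l.2) p q = 4%:R * ev (hessian v x) (ddivL l.2).
    rewrite extd_entry//; last by move=> I; apply: msmooth_smooth; exact: (Ad_msmooth rho_rep rho_alpha rho_beta I Aal).
    have /andP[_ /andP[l01 l1]] := pairs_eta lp.
    rewrite -uaE /dpair !uaD//; last exact: ltn_trans l01 l1.
    by rewrite -mulrBr /ddivL ev_cat ev_sgnL.
  by case: l.1; rewrite ?mulrN.
(* D delta becomes the Laplacian of a single function [v g], up to the sign relating component k to
   component (0, g). *)
rewrite mulKf ?pnatr_eq0// (ev_eqL _ (dirac_sqr27 kp)) ev_sgnL ev_lapL.
have -> : Lap (v (rep27 k).2) = entry p q (F (set_of_seq [:: 0%N; (rep27 k).2])).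
  rewrite /v -[Lap _]/(lap (index_enum 'I_8) _) -good_lap//; last exact: pF.
  by apply: green_op_Lap_eqv (pF _) (kF _) (eF _) => //; exact: form_sign_false.
by rewrite (Lambda27_rep (wL x) kp) signZ /entry; case: (rep27 k).1; rewrite ?mxE.
Qed.

End Complex.

Theorem proposition7p25 (R : realType)
    (rho : ('rV[R]_8 -> 'rV[R]_8) -> 'M[R]_7)
    (rho_rep : representation rho)
    (rho_alpha : rho (@orb_alpha R) = 1%:M)
    (rho_beta : rho (@orb_beta R) = 1%:M)
    (rho_comm : rho (@orb_gamma R) *m rho (@orb_delta R)
                = rho (@orb_delta R) *m rho (@orb_gamma R))
    (rho_nontriv : rho (@orb_gamma R) <> 1%:M \/ rho (@orb_delta R) <> 1%:M)
    (rho_tau : exists P : 'M[R]_7, P \in unitmx /\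
      [/\ P *m rho (@orb_tau R (idx 4)) *m invmx P
            = diag7 [:: -1; -1; -1; -1; 1; 1; 1],
          P *m rho (@orb_tau R (idx 5)) *m invmx P
            = diag7 [:: -1; -1; 1; 1; -1; -1; 1] &
          P *m rho (@orb_tau R (idx 8)) *m invmx P
            = diag7 [:: 1; -1; -1; 1; 1; -1; -1]]) :
  irreducible rho /\ infinitesimally_rigid rho /\ unobstructed rho.
Proof.
split; first exact: acyclic0 rho_rep rho_alpha rho_beta rho_tau.
split; first exact: acyclic1 rho_rep rho_alpha rho_beta rho_tau.
exact: acyclic2 rho_rep rho_alpha rho_beta rho_tau.
Qed.
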